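(* Let $G$ be a compact connected Lie group with a chain of Lie subgroups $G_0<G_1<\dots<G_n=G$, where $K=G_0$ is closed, let $\mathfrak g_0<\mathfrak g_1<\dots<\mathfrak g_n=\mathfrak g$ be the corresponding strictly increasing chain of Lie algebras, $\mathfrak k=\mathfrak g_0$, and let $\langle\cdot,\cdot\rangle$ be an invariant scalar product on $\mathfrak g$. Let $\mathfrak p_i$ be the orthogonal complement of $\mathfrak g_{i-1}$ in $\mathfrak g_i$, $i=1,\dots,n$. Let $\mathcal I\subsetneqq\{1,\dots,n\}$ be such that $\mathfrak d=\bigoplus_{i\in\mathcal I}\mathfrak p_i$ generates $\mathfrak g$ by commutation, let $s_i>0$ for $i\in\mathcal I$ and $s_i=0$ for $i\notin\mathcal I$. Let $ds^2_{\mathcal D_0,s}$ be the $G$-invariant sub-Riemannian structure on $G/K$, on the $G$-invariant distribution $\mathcal D_0$ with $\mathcal D_0|_o\cong\mathfrak d$, induced by the scalar product $$(\xi,\eta)_{\mathfrak d}=\sum_{i\in\mathcal I}\frac1{s_i}\langle\xi_i,\eta_i\rangle,\qquad \xi,\eta\in\mathfrak d,$$ where $o=K\in G/K$. Then the normal sub-Riemannian geodesics on $(G/K,ds^2_{\mathcal D_0,s})$ starting at the origin, $\gamma(0)=o$, are of the form $$\gamma(t)=\exp(ts_n\bar x)\cdot\exp(t(s_{n-1}-s_n)\bar x_{\mathfrak g_{n-1}})\cdots\exp(t(s_1-s_2)\bar x_{\mathfrak g_1})\cdot o,$$ where $\bar x\in\mathfrak g$ satisfies $\mathrm{pr}_{\mathfrak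 k}\bar x=0$.
   Context: For $\xi\in\mathfrak g$ write $\xi_0=\mathrm{pr}_{\mathfrak k}\xi$, $\xi_i=\mathrm{pr}_{\mathfrak p_i}\xi$ for $i\ge1$ (orthogonal projections), and $\xi_{\mathfrak g_i}=\xi_0+\dots+\xi_i\in\mathfrak g_i$. The tangent space $T_o(G/K)$ is identified with $\mathfrak k^\perp=\mathfrak p_1\oplus\dots\oplus\mathfrak p_n$; $g\cdot o$ denotes the natural left action of $G$ on $G/K$. Normal sub-Riemannian geodesics on $G/K$ are the projections to $G/K$ of solutions of the Hamiltonian system on $T^*(G/K)$ with Hamiltonian $H_{sR,0}(q,p)=\tfrac12\|p|_{\mathcal D_0}\|^2$ (dual norm of the sub-Riemannian metric). Equivalently, identify $\mathfrak g^*\cong\mathfrak g$ by $\langle\cdot,\cdot\rangle$ and $T^*G\cong G\times\mathfrak g$ by left trivialization; then $T^*(G/K)$ is the Marsden–Weinstein reduction $(T^*G)_0/K$ of $(T^*G)_0=\{(g,x):\mathrm{pr}_{\mathfrak k}x=0\}$ by the right $K$-action, and $H_{sR,0}$ is induced by the restriction to $(T^*G)_0$ of $H_{sR}(g,x)=\tfrac12\sum_{i=1}^n s_i\langle x_i,x_i\rangle$. *)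

(* Defs.v *)
(* MathComp / MathComp-Analysis, over an arbitrary R : realType. *)
From HB Require Import structures.
From mathcomp Require Import all_boot all_order all_algebra.
From mathcomp Require Import all_classical all_reals all_analysis.

Set Implicit Arguments.
Unset Strict Implicit.
Unset Printing Implicit Defensive.

Import Order.TTheory GRing.Theory Num.Theory numFieldNormedType.Exports.

Local Open Scope classical_set_scope.
Local Open Scope ring_scope.

(* In finite dimension, C^k in the usual sense. *)
Fixpoint Ck_on (R : realType) (V W : normedModType R) (k : nat) (U : set V)
    (f : V -> W) : Prop :=
  match k with
  | 0 => forall x, U x -> {for x, continuous f}
  | k'.+1 => (forall x, U x -> differentiable f x) /\
             (forall v : V, Ck_on k' U (fun x => 'd f x v))
  end.

Definition smooth_on (R : realType) (V W : normedModType R) (U : set V)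
    (f : V -> W) : Prop := forall k, Ck_on k U f.

(* A chart is stored as a pair of total functions; only the values of [coord]
   on [dom] and of [param] on [cim c] are meaningful. *)
Record chart (R : realType) (d : nat) (M : Type) := Chart {
  dom : set M ;
  coord : M -> 'rV[R]_d ;
  param : 'rV[R]_d -> M }.

Definition cim (R : realType) (d : nat) (M : Type) (c : chart R d M) :
  set 'rV[R]_d := coord c @` dom c.

Definition is_chart (R : realType) (d : nat) (M : topologicalType)
    (c : chart R d M) : Prop :=
  [/\ open (dom c), open (cim c),
      forall p, dom c p -> param c (coord c p) = p,
      forall p, dom c p -> {for p, continuous (coord c)} &
      forall x, cim c x -> {for x, continuous (param c)}].

HB.mixin Record isManifold (R : realType) (d : nat) M of Topological M := {
  atlas : set (chart R d M) ;
  atlas_chart : forall c, atlas c -> is_chart c ;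
  atlas_cover : forall p : M, exists2 c, atlas c & dom c p ;
  atlas_compat : forall c1 c2, atlas c1 -> atlas c2 ->
    smooth_on (coord c1 @` (dom c1 `&` dom c2)) (coord c2 \o param c1) ;
  manifold_hausdorff : hausdorff_space M ;
  manifold_second_countable : @second_countable M }.

#[short(type="manifoldType")]
HB.structure Definition Manifold (R : realType) (d : nat) :=
  { M of isManifold R d M & Topological M }.

Definition smooth_map (R : realType) (d e : nat) (M : manifoldType R d)
    (N : manifoldType R e) (f : M -> N) : Prop :=
  continuous f /\
  forall (c1 : chart R d M) (c2 : chart R e N), atlas c1 -> atlas c2 ->
    smooth_on (coord c1 @` (dom c1 `&` f @^-1` dom c2))
              (coord c2 \o f \o param c1).

(* Smoothness of a map out of a product manifold, in product charts. *)
Definition smooth_map2 (R : realType) (d e k : nat) (M : manifoldType R d)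
    (N : manifoldType R e) (P : manifoldType R k) (f : M -> N -> P) : Prop :=
  continuous (fun p : M * N => f p.1 p.2) /\
  forall (c1 : chart R d M) (c2 : chart R e N) (c3 : chart R k P),
    atlas c1 -> atlas c2 -> atlas c3 ->
    smooth_on [set z : 'rV[R]_d * 'rV[R]_e | [/\ cim c1 z.1, cim c2 z.2 &
                 dom c3 (f (param c1 z.1) (param c2 z.2))]]
              (fun z => coord c3 (f (param c1 z.1) (param c2 z.2))).

(* [chart1] is a distinguished chart centred at the neutral element; it serves
   to write tangent vectors at 1 as row vectors, i.e. T_1 G = 'rV[R]_d. *)
HB.mixin Record isLieGroup (R : realType) (d : nat) G of
    Manifold R d G & Group G := {
  mulg_smooth : smooth_map2 (fun x y : G => (x * y)%g) ;
  invg_smooth : smooth_map (fun x : G => (x^-1)%g) ;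
  chart1 : chart R d G ;
  chart1_atlas : atlas chart1 ;
  chart1_dom : dom chart1 1%g ;
  chart1_coord : coord chart1 1%g = 0 }.

#[short(type="lieGroupType")]
HB.structure Definition LieGroup (R : realType) (d : nat) :=
  { G of isLieGroup R d G & Manifold R d G & Group G }.

Section LieTheory.
Variables (R : realType) (d : nat) (G : lieGroupType R d).
Local Notation g := 'rV[R]_d.

Definition co1 : G -> g := coord (@chart1 R d G).
Definition pa1 : g -> G := param (@chart1 R d G).

(* Differential at 1 of conjugation by a. *)
Definition lie_Ad (a : G) (Y : g) : g :=
  'D_Y (fun y => co1 (a * pa1 y * a^-1)%g) 0.

(* [X, Y] = ad_X Y, with ad the differential of Ad at 1. *)
Definition lie_bracket (X Y : g) : g := 'D_X (fun x => lie_Ad (pa1 x) Y) 0.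

(* u is differentiable at t with u'(t) = u(t) . xi, i.e. xi is the velocity in
   the left trivialization TG = G * g. Continuity is required because [co1] is
   meaningful only near 1. *)
Definition left_velocity (u : R -> G) (t : R) (xi : g) : Prop :=
  {for t, continuous u} /\
  is_derive t 1 (fun r : R => co1 ((u t)^-1 * u r)%g) xi.

Definition one_parameter_subgroup (X : g) (c : R -> G) : Prop :=
  (forall r t : R, c (r + t) = (c r * c t)%g) /\ left_velocity c 0 X.

Definition lie_exp (X : g) : G :=
  xget 1%g [set a | exists2 c, one_parameter_subgroup X c & c 1 = a].

Definition lie_subalgebra (h : {vspace g}) : Prop :=
  forall X Y, X \in h -> Y \in h -> lie_bracket X Y \in h.

Definition generates (D : set g) : Prop :=
  forall h : {vspace g}, lie_subalgebra h -> D `<=` [set` h] -> h = fullv.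

Definition scalar_product (B : g -> g -> R) : Prop :=
  [/\ forall a x y z, B (a *: x + y) z = a * B x z + B y z,
      forall x y, B x y = B y x &
      forall x, x != 0 -> 0 < B x x].

Definition Ad_invariant (B : g -> g -> R) : Prop :=
  forall (a : G) x y, B (lie_Ad a x) (lie_Ad a y) = B x y.

End LieTheory.

Definition tangent1 (R : realType) (m d : nat) (H : lieGroupType R m)
    (G : lieGroupType R d) (f : H -> G) (X : 'rV[R]_m) : 'rV[R]_d :=
  'D_X (fun x => co1 (f (pa1 H x))) 0.

(* A is a (not necessarily closed) Lie subgroup with Lie algebra a: the image
   of an injective immersive homomorphism from a Lie group. By homogeneity, it
   is enough to ask for injectivity of the differential at 1. *)
Definition lie_subgroup (R : realType) (d : nat) (G : lieGroupType R d)
    (A : set G) (a : {vspace 'rV[R]_d}) : Prop :=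
  exists (m : nat) (H : lieGroupType R m) (f : H -> G),
    [/\ smooth_map f, {morph f : x y / (x * y)%g}, injective f,
        injective (tangent1 f) &
        A = range f /\ [set` a] = range (tangent1 f)].

Section Homogeneous.
Variables (R : realType) (d : nat) (G : lieGroupType R d).
Local Notation g := 'rV[R]_d.
Variable B : g -> g -> R.

(* Points of G/K are left cosets, seen as subsets of G, with origin o = K. *)
Definition translate (a : G) (A : set G) : set G := [set (a * k)%g | k in A].

Definition orth_proj (W : set g) (x : g) : g :=
  xget 0 [set y | W y /\ forall w, W w -> B (x - y) w = 0].

Variable gs : nat -> {vspace g}.

(* k = g_0 for i = 0, and p_i for i >= 1. *)
Definition pspace (i : nat) : set g :=
  if i is j.+1
  then [set x | x \in gs i /\ forall y, y \in gs j -> B x y = 0]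
  else [set` gs 0%N].

Definition gcomp (i : nat) (x : g) : g := orth_proj (pspace i) x.

Definition gcomp_upto (i : nat) (x : g) : g := \sum_(0 <= j < i.+1) gcomp j x.

Variables (n : nat) (I : pred nat) (s : nat -> R).

Definition dspace : set g :=
  [set xi | exists v : nat -> g, (forall i, I i -> pspace i (v i)) /\
            xi = \sum_(1 <= i < n.+1 | I i) v i].

(* The invariant sub-Riemannian metric at o. *)
Definition sR_metric (xi eta : g) : R :=
  \sum_(1 <= i < n.+1 | I i) (s i)^-1 * B (gcomp i xi) (gcomp i eta).

(* Half the squared dual norm of the restriction of <x, .> to d. The covector
   at g.o represented by (g, x), x orthogonal to k, sends the vector g.xi of
   D_0 to <x, xi>, so this is the Hamiltonian on (T^*G)_0 induced by H_{sR,0};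
   it does not depend on g. *)
Definition sR_hamiltonian (x : g) : R :=
  2^-1 * sup [set (B x xi) ^+ 2 | xi in
                [set xi | dspace xi /\ sR_metric xi xi <= 1]].

(* In the left trivialization T^*G = G * g, the canonical 1-form is
   theta_(g,x)(xi, a) = <x, xi>. This is the canonical symplectic form
   - d theta at (g, x), on the tangent vectors (xi, a) and (eta, b). *)
Definition canonical_symplectic (x : g) (z w : g * g) : R :=
  B z.1 w.2 - B z.2 w.1 + B x (lie_bracket G z.1 w.1).

(* gam is over J the projection to G/K of a solution of the Hamiltonian system
   on T^*(G/K) = (T^*G)_0 / K. A solution in the quotient is described by a
   lift (u, x) to (T^*G)_0. As the pull-back to (T^*G)_0 of the reduced
   symplectic form is the restriction of the canonical one, Hamilton's
   equations in the quotient say that omega((u, x)', w) = dH(w) for every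
   vector w = (eta, b) tangent to (T^*G)_0, i.e. with b orthogonal to k. The
   lift is thus determined by the solution only up to a curve in K. *)
Definition normal_geodesic (K : set G) (J : set R) (gam : R -> set G) : Prop :=
  exists (u : R -> G) (x xi a : R -> g), forall t : R, J t ->
    [/\ gam t = translate (u t) K,
        gcomp 0 (x t) = 0,
        left_velocity u t (xi t),
        is_derive t 1 x (a t) &
        forall eta b : g, gcomp 0 b = 0 ->
          canonical_symplectic (x t) (xi t, a t) (eta, b) =
          'D_b sR_hamiltonian (x t)].

End Homogeneous.

(* Main.v *)
Require Import Defs.
From HB Require Import structures.
From mathcomp Require Import all_boot all_order all_algebra.
From mathcomp Require Import all_classical all_reals all_analysis.
From mathcomp Require Import ring lra.

Set Implicit Arguments.
Unset Strict Implicit.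
Unset Printing Implicit Defensive.

Import Order.TTheory GRing.Theory Num.Theory numFieldNormedType.Exports.

Local Open Scope classical_set_scope.
Local Open Scope ring_scope.

(** A lift (u, x) of a normal geodesic satisfies u' = u.xi and x' = - [xi, x],
    where xi is equal modulo k to s(x), the sum of the s_i x_i. So Ad_u x is a
    constant X.

    Let w = e_n ... e_1 be the product of exponentials built from X, and put z
    = Ad_(w^-1) X. As Ad_(e_i) fixes X_(g_i) and preserves g_j for all j >= i,
    the projection of z to g_i is Ad_((e_i ... e_1)^-1) X_(g_i). By summation
    by parts the velocity of w is then s(z), so that (w, z) is a lift of a
    geodesic.

    For an arbitrary lift, h = w^-1 u satisfies h' = h.(kappa + s(x) -
    Ad_(h^-1) s(z)) with kappa = xi - s(x) in k and x = Ad_(h^-1) z. As s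
    commutes with Ad_k for k in K, the part of this velocity which is
    transverse to K is bounded by the distance from h to K, and h stays in K
    by a Gronwall argument. The k-component of xi is an arbitrary function,
    not known to be integrable, so this argument is carried out with discrete
    steps. It only requires that every vector of k is the velocity of a curve
    in K.

    Exponentials exist because G is compact: they are ultralimits of discrete
    one-parameter semigroups. *)

(** The explicit product supplies the existence of flows, and two estimates supply uniqueness:
    skewness of ad, which makes a squared length constant, and the discrete Gronwall bound. The case
    K = {1} of the latter also gives uniqueness of one-parameter subgroups. Every velocity is
    translated to the neutral element and read as a first-order expansion in the single chart there
    ([vel]). Products, inverses and powers then come from one estimate: pa x * pa y = pa z with z -
    x - y small relative to y alone.

    The exponentials are built in G, without any proof that they stay in G_i, which may fail to be
    closed. That Ad_(e_i) preserves g_j is therefore deduced from its generator, which lies in g_i: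
    its ad preserves g_j and is skew.

    The operator s commutes with Ad_k because K lies in every G_i, so that Ad_k is an isometry
    preserving every g_i. The bound on the transverse velocity follows: at h = pa y * k, Ad_k turns
    this velocity into the commutator of s with Ad of (pa y)^-1, which is zero at y = 0 and O(|y|)
    nearby. *)

Local Ltac rowring := apply/rowP => ?; rewrite !mxE; ring.

(** * Calculus in normed spaces *)

(** Multiplying by h turns the difference quotient into an inequality that is trivial at h = 0, so
    the punctured filter becomes a plain one. *)
Lemma is_derive1P (R : realType) (W : normedModType R) (f : R -> W) (t : R)
  (X : W) : is_derive t 1 f X <->
  forall e : R, 0 < e ->
    \forall h \near (0 : R), `|f (h + t) - f t - h *: X| <= e * `|h|.
Proof.
have quot (h : R) : h != 0 -> forall e : R,
    (`|X - h^-1 *: (f (h *: 1 + t) - f t)| <= e) =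
    (`|f (h + t) - f t - h *: X| <= e * `|h|).
  move=> h0 e; rewrite [h *: 1]mulr1 -[in RHS]normrN opprB.
  rewrite -ler_pdivrMr ?normr_gt0// mulrC -normfV -normrZ.
  by rewrite [h^-1 *: (h *: X - _)]scalerBr scalerA mulVf// scale1r.
split.
  move=> [df dE] e e0.
  have : (fun h : R => h^-1 *: ((f \o shift t) (h *: 1) - f t)) @ 0^' --> X.
    by rewrite -dE; exact: df.
  move/cvgrPdist_le => /(_ e e0); rewrite near_withinE; apply: filterS => h H.
  have [->|h0] := eqVneq h 0;
    first by rewrite add0r subrr scale0r subr0 !normr0 mulr0.
  by rewrite -quot//; exact: H.
move=> H.
have C : (fun h : R => h^-1 *: ((f \o shift t) (h *: 1) - f t)) @ 0^' --> X.
  apply/cvgrPdist_le => e e0; rewrite near_withinE.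
  by move: (H e e0); apply: filterS => h Hh h0; rewrite /= quot.
by apply: DeriveDef; [apply/cvg_ex; exists X | apply: cvg_lim].
Qed.

Lemma differentiable_near (R : realType) (V W : normedModType R) (f : V -> W)
  (x : V) : differentiable f x -> forall e : R, 0 < e ->
  \forall h \near (0 : V), `|f (h + x) - f x - 'd f x h| <= e * `|h|.
Proof.
move=> /diff_locallyx; set k := 'o _ => H e e0.
have : \forall h \near (0 : V), `|k h| <= e * `|h|.
  exact: (littleoP [littleo of k]).
apply: filterS => h; apply: le_trans.
by rewrite H -[_ - f x - _]addrA -opprD addrAC subrr add0r.
Qed.

Lemma rV_coord_le (R : realType) (d : nat) (x : 'rV[R]_d) i : `|x 0 i| <= `|x|.
Proof.
by rewrite [leRHS]/Num.Def.normr/= mx_normrE; exact: (le_bigmax _ _ (0, i)).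
Qed.

Lemma rV_norm_le (R : realType) (d : nat) (x : 'rV[R]_d) (e : R) : 0 <= e ->
  (forall i, `|x 0 i| <= e) -> `|x| <= e.
Proof.
move=> e0 H; rewrite [leLHS]/Num.Def.normr/= mx_normrE (bigmax_le _ e0)//.
by move=> [i j] _ /=; rewrite ord1.
Qed.

Lemma sum_norm_le (R : realType) (d : nat) (W : normedModType R)
  (x : 'rV[R]_d) (F : 'I_d -> W) :
  `|\sum_i x 0 i *: F i| <= `|x| * \sum_i `|F i|.
Proof.
rewrite (le_trans (ler_norm_sum _ _ _))// mulr_sumr ler_sum// => i _.
by rewrite normrZ ler_wpM2r// rV_coord_le.
Qed.

Lemma linear_rV_sum (R : realType) (d : nat) (W : normedModType R)
  (f : {linear 'rV[R]_d -> W}) x : f x = \sum_i x 0 i *: f (delta_mx 0 i).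
Proof.
rewrite {1}[x]row_sum_delta linear_sum.
by apply: eq_bigr => i _; rewrite linearZ.
Qed.

Lemma linear_rV_bound (R : realType) (d : nat) (W : normedModType R)
  (f : {linear 'rV[R]_d -> W}) : exists2 C : R, 0 < C &
  forall x, `|f x| <= C * `|x|.
Proof.
exists (1 + \sum_i `|f (delta_mx 0 i)|); first by rewrite ltr_pwDl ?sumr_ge0.
move=> x; rewrite linear_rV_sum (le_trans (sum_norm_le _ _))// mulrC.
by rewrite ler_wpM2r// lerDr.
Qed.

Lemma continuous_linear_rV (R : realType) (d : nat) (W : normedModType R)
  (f : {linear 'rV[R]_d -> W}) : continuous f.
Proof.
apply/linear_bounded_continuous/linear_boundedP.
have [C C0 fC] := linear_rV_bound f; near=> r => x.
by rewrite (le_trans (fC x))// ler_wpM2r//; near: r; exact: nbhs_pinfty_ge.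
Unshelve. all: by end_near. Qed.

Lemma is_diffP (R : realType) (d : nat) (W : normedModType R)
  (f : 'rV[R]_d -> W) (x : 'rV[R]_d) (L : {linear 'rV[R]_d -> W}) :
  (forall e : R, 0 < e ->
     \forall h \near (0 : 'rV[R]_d), `|f (h + x) - f x - L h| <= e * `|h|) ->
  is_diff x f L.
Proof.
move=> H; have E : f \o shift x = cst (f x) + L +o_ (0 : 'rV[R]_d) id.
  apply/eqaddoP => e e0; move: (H e e0); apply: filterS => h /=.
  by rewrite opprD addrA.
have dE := diff_unique (@continuous_linear_rV _ _ _ L) E.
split => //; apply/diff_locallyP; rewrite dE; split => //.
exact: continuous_linear_rV.
Qed.

Lemma is_derive_comp_diff (R : realType) (V W : normedModType R) (c : R -> V)
  (f : V -> W) (t : R) (X : V) : is_derive t 1 c X ->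
  differentiable f (c t) -> is_derive t 1 (f \o c) ('d f (c t) X).
Proof.
move=> [/derivable1_diffP dc cX] df.
have dfc : differentiable (f \o c) t by exact: differentiable_comp.
apply: DeriveDef; first exact/derivable1_diffP.
by rewrite -cX (deriveE _ dfc) (deriveE _ dc) diff_comp.
Qed.

Lemma is_derive_mxP (R : realType) (d : nat) (c : R -> 'rV[R]_d) (t : R)
  (X : 'rV[R]_d) : is_derive t 1 c X <->
  forall i, is_derive t 1 (fun r => c r 0 i) (X 0 i).
Proof.
split=> [[dc cX] i|H].
  apply: DeriveDef; first by move/derivable_mxP : dc; exact.
  by rewrite -cX derive_mx// mxE.
have dc : derivable c t 1.
  by apply/derivable_mxP => i j; rewrite ord1; have [] := H j.
apply: DeriveDef => //; apply/rowP => i; rewrite derive_mx// mxE.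
by have [_ ->] := H i.
Qed.

(** The norm is the maximum of the coordinates, so the scalar mean value theorem may pick its own
    intermediate point for each coordinate and still give the constant [e]. *)
Lemma mean_value_rV (R : realType) (d : nat) (c c' : R -> 'rV[R]_d)
  (v : 'rV[R]_d) (e : R) : 0 <= e ->
  (forall s : R, 0 <= s <= 1 -> is_derive s 1 c (c' s)) ->
  (forall s : R, 0 <= s <= 1 -> `|c' s - v| <= e) -> `|c 1 - c 0 - v| <= e.
Proof.
move=> e0 dc c'v; apply: rV_norm_le => // i.
have dci (s : R) : 0 <= s <= 1 -> is_derive s 1 (fun r => c r 0 i) (c' s 0 i).
  by move=> /dc/is_derive_mxP.
have := @MVT R (fun r => c r 0 i) (fun r => c' r 0 i) 0 1 ltr01.
case=> [s|| s].
- by rewrite in_itv/= => /andP[s0 s1]; apply: dci; rewrite !ltW.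
- apply: derivable_within_continuous => s; rewrite in_itv/= => /dci[].
  by [].
rewrite in_itv/= => /andP[s0 s1]; rewrite subr0 mulr1 => E.
have s01 : 0 <= s <= 1 by rewrite !ltW.
rewrite !mxE E; have := le_trans (rV_coord_le _ i) (c'v s s01).
by rewrite !mxE.
Qed.

Lemma is_derive0_cst (R : realType) (J : set R) (f : R -> R) : is_interval J ->
  (forall t, J t -> is_derive t 1 f 0) -> forall a b, J a -> J b -> f a = f b.
Proof.
move=> itvJ df; suff lt_cst a b : J a -> J b -> a < b -> f a = f b.
  by move=> a b Ja Jb; have [/lt_cst->//|/lt_cst->//|->] := ltgtP a b.
move=> Ja Jb ab; have inJ s : s \in `[a, b] -> J s.
  by rewrite in_itv/= => sab; exact: itvJ sab.
have [s sab|| s _] := @MVT R f (fun=> 0) a b ab.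
- by apply/df/inJ/subset_itv_oo_cc.
- by apply: derivable_within_continuous => s /inJ/df[].
by rewrite mul0r => /eqP; rewrite subr_eq0 => /eqP.
Qed.

Lemma is_derive_affine (R : realType) (V : normedModType R) (p v : V) (t : R) :
  is_derive t 1 (fun r : R => p + r *: v) v.
Proof.
apply/is_derive1P => e e0; apply: filterE => h.
by rewrite scalerDl addrCA addrK subrr normr0 mulr_ge0// ltW.
Qed.

Lemma is_derive_unique (R : realType) (V : normedModType R) (f : R -> V)
  (t : R) (X Y : V) : is_derive t 1 f X -> is_derive t 1 f Y -> X = Y.
Proof. by move=> [_ <-] [_ <-]. Qed.

(** Linearity in [y] reduces a bound uniform in [y] to finitely many continuous functions, the
    values on the basis. *)
Lemma linear_near_id (R : realType) (V : normedModType R) (d : nat)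
  (L : V -> 'rV[R]_d -> 'rV[R]_d) (z0 : V) :
  (forall z y, L z y = \sum_i y 0 i *: L z (delta_mx 0 i)) ->
  (forall i, {for z0, continuous (fun z => L z (delta_mx 0 i))}) ->
  (forall y, L z0 y = y) ->
  forall e : R, 0 < e -> \forall z \near z0, forall y, `|L z y - y| <= e * `|y|.
Proof.
move=> linL cL Lid e e0.
(* The summand 1 keeps the quotient meaningful when d = 0. *)
have e'0 : 0 < e / (d%:R + 1) by rewrite divr_gt0// ltr_wpDl.
have : \forall z \near z0, forall i, `|L z (delta_mx 0 i) - delta_mx 0 i| <=
  e / (d%:R + 1).
  apply: filter_forall => i; have /cvgrPdist_le/(_ _ e'0) := cL i.
  by apply: filterS => z; rewrite Lid distrC.
apply: filterS => z Lz y.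
have -> : L z y - y = \sum_i y 0 i *: (L z (delta_mx 0 i) - delta_mx 0 i).
  rewrite linL {2}[y]row_sum_delta -sumrB.
  by apply: eq_bigr => i _; rewrite scalerBr.
rewrite (le_trans (sum_norm_le _ _))// mulrC ler_wpM2r//.
rewrite (le_trans (ler_sum _ (fun i _ => Lz i)))// sumr_const card_ord.
by rewrite -[X in X <= _]mulr_natr -mulrA ger_pMr//
  mulrC ler_pdivrMr ?mul1r ?lerDl// ltr_wpDl.
Qed.

Lemma pair_l_sum (R : realType) (d : nat) (x : 'rV[R]_d) :
  (x, 0) = \sum_i x 0 i *: (delta_mx 0 i, 0) :> 'rV[R]_d * 'rV[R]_d.
Proof.
apply/pair_eqP/andP; split=> /=; apply/eqP.
  by rewrite raddf_sum {1}[x]row_sum_delta.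
by rewrite raddf_sum big1// => i _; rewrite /= scaler0.
Qed.

Lemma pair_r_sum (R : realType) (d : nat) (x : 'rV[R]_d) :
  (0, x) = \sum_i x 0 i *: (0, delta_mx 0 i) :> 'rV[R]_d * 'rV[R]_d.
Proof.
apply/pair_eqP/andP; split=> /=; apply/eqP.
  by rewrite raddf_sum big1// => i _; rewrite /= scaler0.
by rewrite raddf_sum {1}[x]row_sum_delta.
Qed.

Lemma near_addP (R : realType) (t : R) (P : R -> Prop) :
  (\forall s \near t, P s) <-> (\forall h \near (0 : R), P (h + t)).
Proof. by have := near_shift 0 t P; rewrite subr0 => ->. Qed.

(** * The group law in the chart at the neutral element *)

Section Chart.
Variables (R : realType) (d : nat) (G : lieGroupType R d).
Local Notation g := 'rV[R]_d.
Local Notation co := (@co1 R d G).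
Local Notation pa := (@pa1 R d G).
Implicit Types (x y X Y : g) (a b : G).

Lemma is_chart1 : is_chart (@chart1 R d G).
Proof. exact/atlas_chart/chart1_atlas. Qed.

Lemma pa1_0 : pa 0 = 1%g.
Proof.
have [_ _ /(_ 1%g chart1_dom)] := is_chart1.
by rewrite chart1_coord.
Qed.

Lemma mulg_continuous : continuous (fun p : G * G => (p.1 * p.2)%g).
Proof. by have [] := @mulg_smooth R d G. Qed.

Lemma invg_continuous : continuous (fun p : G => (p^-1)%g).
Proof. by have [] := @invg_smooth R d G. Qed.

Lemma cim1_0 : cim (@chart1 R d G) 0.
Proof. by exists 1%g; [exact: chart1_dom|exact: chart1_coord]. Qed.

Lemma chart1_ball : exists2 r : R, 0 < r &
  forall y, `|y| <= r -> [/\ cim (@chart1 R d G) y, dom chart1 (pa y) &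
                             co (pa y) = y].
Proof.
have [_ oc pK _ _] := is_chart1.
have /nbhs_norm0P[r /= r0 H] := open_nbhs_nbhs (conj oc cim1_0).
exists (r / 2); first by rewrite divr_gt0.
move=> y yr; have cy : cim (@chart1 R d G) y.
  by apply: H => /=; rewrite (le_lt_trans yr)// ltr_pdivrMr// ltr_pMr// ltr1n.
split=> //; case: (cy) => p dp <-; first by rewrite /pa1 pK.
by rewrite /pa1 pK.
Qed.

Lemma pa1_continuous : {for 0, continuous pa}.
Proof.
by have [_ _ _ _] := is_chart1; apply; exact: cim1_0.
Qed.

Lemma near1_pa1 (e : R) : 0 < e ->
  \forall p \near (1%g : G), exists2 y, `|y| <= e & p = pa y.
Proof.
have [od _ pK cc _] := is_chart1 => e0.
have dp : \forall p \near (1%g : G), dom chart1 p.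
  exact: open_nbhs_nbhs (conj od chart1_dom).
have cp : \forall p \near (1%g : G), `|co p| <= e.
  have /cvgrPdist_le/(_ e e0) : co p @[p --> (1%g : G)] --> co 1%g.
    exact: cc chart1_dom.
  by apply: filterS => p; rewrite /co1 chart1_coord sub0r normrN.
by apply: filterS2 dp cp => p Dp Cp; exists (co p) => //; rewrite /pa1 pK.
Qed.

Lemma near_pa1 (V : set G) : nbhs (1%g : G) V ->
  exists2 e : R, 0 < e & forall y, `|y| <= e -> V (pa y).
Proof.
rewrite -pa1_0 => /pa1_continuous /nbhs_norm0P[r /= r0 H].
exists (r / 2); first by rewrite divr_gt0.
by move=> y yr; apply: H => /=;
  rewrite (le_lt_trans yr)// ltr_pdivrMr// ltr_pMr// ltr1n.
Qed.

Definition mulg_chart_dom : set (g * g) := [set z | [/\ cim (@chart1 R d G) z.1,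
  cim (@chart1 R d G) z.2 & dom (@chart1 R d G) (pa z.1 * pa z.2)%g]].
Definition mulg_chart (z : g * g) : g := co (pa z.1 * pa z.2)%g.

Lemma mulg_chart_smooth : smooth_on mulg_chart_dom mulg_chart.
Proof. by have [_] := @mulg_smooth R d G; apply; exact: chart1_atlas. Qed.

Lemma mulg_chart_dom_ball : exists2 r : R, 0 < r & forall x y, `|x| <= r ->
  `|y| <= r -> mulg_chart_dom (x, y).
Proof.
have [od _ _ _ _] := is_chart1.
have [r r0 H] := chart1_ball.
have : nbhs ((1%g, 1%g) : G * G) [set p | dom (@chart1 R d G) (p.1 * p.2)%g].
  apply: mulg_continuous; rewrite /= mulg1.
  exact: open_nbhs_nbhs (conj od chart1_dom).
case=> -[A B] /= [/near_pa1[e e0 He] /near_pa1[e' e'0 He']] AB.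
exists (Num.min r (Num.min e e')); first by rewrite !lt_min r0 e0 e'0.
move=> x y; rewrite !le_min => /and3P[xr xe xe'] /and3P[yr ye ye'].
split => /=; [by have [] := H x xr|by have [] := H y yr|].
by apply: (AB (pa x, pa y)); split => /=; [exact: He|exact: He'].
Qed.

Lemma mulg_chart_unit : exists2 r : R, 0 < r & forall x, `|x| <= r ->
  mulg_chart (x, 0) = x /\ mulg_chart (0, x) = x.
Proof.
have [r r0 H] := chart1_ball; exists r => // x xr.
by rewrite /mulg_chart/= pa1_0 mulg1 mul1g; have [] := H x xr.
Qed.

Lemma mulg_chart_differentiable z : mulg_chart_dom z ->
  differentiable mulg_chart z.
Proof. by have [dm _] := mulg_chart_smooth 1; exact: dm. Qed.

Lemma mulg_chart_diff_continuous z v : mulg_chart_dom z ->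
  {for z, continuous (fun z => 'd mulg_chart z v)}.
Proof. by have [_ dm] := mulg_chart_smooth 1 => Uz; exact: dm. Qed.

Lemma mulg_chart_diff2 z v : mulg_chart_dom z -> differentiable (fun z =>
  'd mulg_chart z v) z.
Proof. by have [_ /(_ v)[dm _]] := mulg_chart_smooth 2; exact: dm. Qed.

Lemma mulg_chart_dom0 : mulg_chart_dom (0, 0).
Proof. by have [r /ltW r0] := mulg_chart_dom_ball; apply; rewrite normr0. Qed.

Lemma near0_scale y (r : R) : 0 < r -> \forall h \near (0 : R), `|h *: y| <= r.
Proof.
move=> r0; have /cvgrPdist_le/(_ _ r0) : h *: y @[h --> (0 : R)] --> 0 *: y.
  exact: scalel_continuous.
by apply: filterS => h; rewrite scale0r sub0r normrN.
Qed.

Lemma dmulg_chart0_r y : 'd mulg_chart (0, 0) (0, y) = y.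
Proof.
have [r r0 Hr] := mulg_chart_unit.
have D := is_derive_affine (0 : g * g) ((0, y) : g * g) 0.
have := is_derive_comp_diff D (f := mulg_chart).
rewrite scale0r addr0 => /(_ (mulg_chart_differentiable mulg_chart_dom0))
  /is_derive_unique; apply.
apply/is_derive1P => e e0; move: (near0_scale y r0); apply: filterS => h hr.
rewrite /= addr0 scale0r addr0 add0r.
have -> : h *: ((0, y) : g * g) = (0, h *: y) by congr pair; rewrite /= scaler0.
have -> : (0 : g * g) = (0, 0) by [].
have [_ ->] := Hr _ hr; have [|-> _] := Hr 0; first by rewrite normr0 ltW.
by rewrite subr0 subrr normr0 mulr_ge0// ltW.
Qed.

Lemma dmulg_chart0_l y : 'd mulg_chart (0, 0) (y, 0) = y.
Proof.
have [r r0 Hr] := mulg_chart_unit.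
have D := is_derive_affine (0 : g * g) ((y, 0) : g * g) 0.
have := is_derive_comp_diff D (f := mulg_chart).
rewrite scale0r addr0 => /(_ (mulg_chart_differentiable mulg_chart_dom0))
  /is_derive_unique; apply.
apply/is_derive1P => e e0; move: (near0_scale y r0); apply: filterS => h hr.
rewrite /= addr0 scale0r addr0 add0r.
have -> : h *: ((y, 0) : g * g) = (h *: y, 0) by congr pair; rewrite /= scaler0.
have -> : (0 : g * g) = (0, 0) by [].
have [-> _] := Hr _ hr; have [|-> _] := Hr 0; first by rewrite normr0 ltW.
by rewrite subr0 subrr normr0 mulr_ge0// ltW.
Qed.

Lemma dmulg_chart_near_r (e : R) : 0 < e ->
  \forall z \near ((0, 0) :
    g * g), forall y, `|'d mulg_chart z (0, y) - y| <= e * `|y|.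
Proof.
pose L (z : g * g) y : g := 'd mulg_chart z (0, y).
have sumL z y : L z y = \sum_i y 0 i *: L z (delta_mx 0 i).
  by rewrite /L pair_r_sum linear_sum; apply: eq_bigr => i _; rewrite linearZ.
have cL i : {for ((0, 0) : g * g), continuous (fun z => L z (delta_mx 0 i))}.
  exact: mulg_chart_diff_continuous mulg_chart_dom0.
move=> e0; have := @linear_near_id R _ d L (0, 0) sumL cL dmulg_chart0_r e e0.
exact: id.
Qed.

Lemma dmulg_chart_near_l (e : R) : 0 < e ->
  \forall z \near ((0, 0) :
    g * g), forall y, `|'d mulg_chart z (y, 0) - y| <= e * `|y|.
Proof.
pose L (z : g * g) y : g := 'd mulg_chart z (y, 0).
have sumL z y : L z y = \sum_i y 0 i *: L z (delta_mx 0 i).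
  by rewrite /L pair_l_sum linear_sum; apply: eq_bigr => i _; rewrite linearZ.
have cL i : {for ((0, 0) : g * g), continuous (fun z => L z (delta_mx 0 i))}.
  exact: mulg_chart_diff_continuous mulg_chart_dom0.
move=> e0; have := @linear_near_id R _ d L (0, 0) sumL cL dmulg_chart0_l e e0.
exact: id.
Qed.

Lemma near_pair_ball (P : g * g -> Prop) : (\forall z \near ((0, 0) :
  g * g), P z) ->
  exists2 r : R, 0 < r & forall x y, `|x| <= r -> `|y| <= r -> P (x, y).
Proof.
move=> /nbhs_norm0P[r /= r0 H]; exists (r / 2); first by rewrite divr_gt0.
have r2 : r / 2 < r by rewrite ltr_pdivrMr// ltr_pMr// ltr1n.
move=> x y xr yr; apply: H => /=.
by rewrite prod_normE/= gt_max (le_lt_trans xr)// (le_lt_trans yr).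
Qed.

(** Mean value inequality along the segment from (x, 0) to (x, y), where the partial differential is
    e-close to the identity. The error is relative to |y| alone, which lets errors add up over many
    small right factors. *)
Lemma mulg_chart_estimate (e : R) : 0 < e -> exists2 r : R, 0 < r &
  forall x y, `|x| <= r -> `|y| <= r ->
    exists2 z, `|z - x - y| <= e * `|y| & (pa x * pa y)%g = pa z.
Proof.
move=> e0; have [r1 r10 H1] := mulg_chart_dom_ball;
  have [r2 r20 H2] := mulg_chart_unit.
have [r3 r30 H3] := near_pair_ball (dmulg_chart_near_r e0).
exists (Num.min r1 (Num.min r2 r3)); first by rewrite !lt_min r10 r20 r30.
move=> x y; rewrite !le_min => /and3P[xr1 xr2 xr3] /and3P[yr1 yr2 yr3].
exists (mulg_chart (x, y)); last first.
  have [_ _ /= dxy] := H1 _ _ xr1 yr1.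
  by have [_ _ pK _ _] := is_chart1; rewrite /mulg_chart/= /pa1 pK.
have sy (s : R) r : 0 <= s <= 1 -> `|y| <= r -> `|s *: y| <= r.
  move=> /andP[s0 s1] yr; rewrite normrZ (le_trans _ yr)// ler_piMl//.
  by rewrite ger0_norm.
pose c (s : R) := mulg_chart ((x, 0) + s *: ((0, y) : g * g)).
have -> : mulg_chart (x, y) = c 1.
  congr mulg_chart; rewrite scale1r; congr pair; rewrite /= ?addr0 ?add0r//.
have cE (s : R) : (x, 0) + s *: ((0, y) : g * g) = (x, s *: y).
  by congr pair; rewrite /= ?scaler0 ?addr0 ?add0r.
have {1}-> : x = c 0 by rewrite /c cE scale0r; have [] := H2 _ xr2.
apply: (@mean_value_rV _ _ _ (fun s => 'd mulg_chart (x, s *: y) (0, y))).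
- by rewrite mulr_ge0// ltW.
- move=> s s01; rewrite -cE; apply:
  (is_derive_comp_diff (is_derive_affine _ _ _)).
  by apply: mulg_chart_differentiable; rewrite cE; apply: H1 => //; exact: sy.
- by move=> s s01; apply: H3 => //; exact: sy.
Qed.

Lemma cvgMg (T : Type) (F : set_system T) {FF : Filter F} (f h : T -> G) a b :
  f @ F --> a -> h @ F --> b -> (fun t => (f t * h t)%g) @ F --> (a * b)%g.
Proof. by move=> fa hb; exact: (cvg_comp2 (h := fun x y : G =>
  (x * y)%g) fa hb (@mulg_continuous (a, b))). Qed.

Lemma cvgVg (T : Type) (F : set_system T) {FF : Filter F} (f : T -> G) a :
  f @ F --> a -> (fun t => ((f t)^-1)%g) @ F --> (a^-1)%g.
Proof. by move=> fa; apply: (cvg_comp _ _ fa); exact: invg_continuous. Qed.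

(** * Velocities and the adjoint action *)

(* [q] passes through 1 at time 0 with velocity [X]; this includes [q 0 = 1] and
   the continuity at 0. *)
Definition vel (q : R -> G) X := forall e : R, 0 < e ->
  \forall t \near (0 : R), exists2 y, `|y - t *: X| <= e * `|t| & q t = pa y.

Lemma vel_get (q : R -> G) X (e r : R) : vel q X -> 0 < e -> 0 < r ->
  \forall t \near (0 : R), exists y,
    [/\ `|y - t *: X| <= e * `|t|, `|y| <= (e + `|X|) * `|t|, `|y| <= r &
      q t = pa y].
Proof.
move=> qX e0 r0; have C0 : 0 < e + `|X| by rewrite ltr_wpDr.
have : \forall t \near (0 : R), `|t| <= r / (e + `|X|).
  by apply: nbhs0_le; rewrite divr_gt0.
apply: filterS2 (qX e e0) => t [y yt qt] tr; exists y.
have ye : `|y| <= (e + `|X|) * `|t|.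
  rewrite -(subrK (t *: X) y) (le_trans (ler_normD _ _))// mulrDl normrZ.
  by rewrite (mulrC `|X|) lerD2r.
by split => //; rewrite (le_trans ye)// mulrC -ler_pdivlMr.
Qed.

Lemma pa1_inj_near : exists2 r : R, 0 < r &
  forall x y, `|x| <= r -> `|y| <= r -> pa x = pa y -> x = y.
Proof.
have [r r0 H] := chart1_ball; exists r => // x y xr yr E.
by have [_ _ <-] := H x xr; rewrite E; have [_ _ ->] := H y yr.
Qed.

(** Continuity of [u] brings the increment u(t)^-1 u(t + h) into the chart, where [co1] inverts
    [pa1]; conversely, the expansion forces the increment to tend to 1. *)
Lemma left_velocityP (u : R -> G) (t : R) X :
  left_velocity u t X <-> vel (fun h => ((u t)^-1 * u (h + t)%R)%g) X.
Proof.
have [r r0 Hr] := chart1_ball.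
split=> [[cu /is_derive1P du] e e0|H].
  have cq : ((u t)^-1 * u (h + t)%R)%g @[h --> (0 : R)] --> (1%g : G).
    rewrite -(mulVg (u t)).
    apply: cvgMg; first exact: cvg_cst.
    move=> V Vu; have /near_addP : \forall s \near t, V (u s) by exact: cu.
    exact.
  have H : \forall h \near (0 : R), exists2 y : g, `|y| <= r &
      ((u t)^-1 * u (h + t)%R)%g = pa y by exact: cq (near1_pa1 r0).
  apply: filterS2 H (du e e0) => h [y yr yE] dh.
  exists y; last exact: yE.
  by move: dh; rewrite yE mulVg {2}/co1 chart1_coord subr0;
    have [_ _ ->] := Hr y yr.
split; last first.
  apply/is_derive1P => e e0; have := vel_get H e0 r0; apply: filterS =>
    h [y [yt _ yr qE]].
  rewrite mulVg {2}/co1 chart1_coord subr0 qE.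
  by have [_ _ ->] := Hr y yr.
move=> V VN; have : nbhs (1%g : G) [set p | V (u t * p)%g].
  have : (u t * p)%g @[p --> (1%g : G)] --> (u t * 1)%g.
    by apply: cvgMg; [exact: cvg_cst|exact: cvg_id].
  by rewrite mulg1; apply.
move=> /near_pa1[e e0 He].
suff : \forall s \near t, V (u s) by [].
apply/near_addP; apply: filterS (vel_get H ltr01 e0) => h [y [_ _ /He Vy qE]];
  rewrite -(mulVKg (u t) (u _)) qE; exact: Vy.
Qed.

Lemma vel_mul (p q : R -> G) X Y : vel p X -> vel q Y ->
  vel (fun t => (p t * q t)%g) (X + Y).
Proof.
move=> pX qY e e0; have e3 : 0 < e / 3 by rewrite divr_gt0.
have C0 : 0 < e / 3 + `|Y| by rewrite ltr_wpDr.
(* The product estimate costs a multiple of |y| <= (e / 3 + |Y|) |t|; this factor turns the cost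
   into (e / 3) |t|. *)
have e30 : 0 < e / 3 / (e / 3 + `|Y|) by rewrite divr_gt0.
have [r r0 Hr] := mulg_chart_estimate e30.
apply: filterS2 (vel_get pX e3 r0) (vel_get qY e3 r0).
move=> t [x [xX _ xr pE]] [y [yY ye yr qE]].
have [z zxy E] := Hr x y xr yr.
exists z; last by rewrite pE qE E.
rewrite scalerDr.
have -> : z - (t *: X + t *: Y) = (z - x - y) + ((x - t *: X) + (y - t *: Y)).
  by rowring.
rewrite (le_trans (ler_normD _ _))// (_ :
  e * `|t| = e / 3 * `|t| + (e / 3 * `|t| + e / 3 * `|t|)); last by field.
rewrite lerD//; last by rewrite (le_trans (ler_normD _ _))// lerD.
apply: (le_trans zxy); rewrite mulrAC ler_pdivrMr// -[leRHS]mulrA.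
by apply: ler_wpM2l; [exact: ltW|rewrite mulrC].
Qed.

(** Continuity of inversion provides a small [y] with (pa x)^-1 = pa y. The product estimate applied
    to pa x * pa y = pa 0 then gives |x + y| <= e1 |y|, hence y = - x to first order. *)
Lemma vel_inv (p : R -> G) X : vel p X -> vel (fun t => ((p t)^-1)%g) (- X).
Proof.
(* The bound 1/2 yields |y| <= 2 |x|; the other one makes e1 |y| at most (e / 2) |t|, since |x| <=
   (1 + |X|) |t|. *)
move=> pX e e0; pose e1 := Num.min (2^-1) (e / 4 / (1 + `|X|)).
have C0 : 0 < 1 + `|X| by rewrite ltr_wpDr.
have e10 : 0 < e1 by rewrite lt_min invr_gt0 ltr0n !divr_gt0.
have [r r0 Hr] := mulg_chart_estimate e10; have [r' r'0 inj] := pa1_inj_near.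
pose s := Num.min r (r' / 3).
have s0 : 0 < s by rewrite lt_min r0 divr_gt0.
have invs : \forall q \near (1%g : G), exists2 y, `|y| <= s & (q^-1)%g = pa y.
  have : ((q : G)^-1)%g @[q --> (1%g : G)] --> (1%g : G).
    by rewrite -[X in _ --> X]invg1; exact: cvgVg cvg_id.
  by move=> /(_ _ (near1_pa1 s0)).
have [s' s'0 Hs'] := near_pa1 invs.
pose e2 := Num.min 1 (e / 2).
have e20 : 0 < e2 by rewrite lt_min ltr01 divr_gt0.
have ss0 : 0 < Num.min s s' by rewrite lt_min s0.
apply: filterS (vel_get pX e20 ss0) => t [x [xX xe]].
rewrite le_min => /andP[xs xs'] pE.
have [y ys yE] := Hs' x xs'; exists y; last by rewrite pE.
move: xs ys; rewrite !le_min => /andP[xr xr'] /andP[yr yr'].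
have [z zxy] := Hr x y xr yr; rewrite -yE mulgV -pa1_0.
have e1l : e1 <= 2^-1 by rewrite ge_min lexx.
have zr : `|z| <= r'.
  have -> : z = (z - x - y) + (x + y) by rowring.
  rewrite (le_trans (ler_normD _ _))//.
  rewrite (_ : r' = r' / 3 + (r' / 3 + r' / 3)); last by field.
  rewrite lerD//; last by rewrite (le_trans (ler_normD _ _))// lerD.
  have := ler_wpM2r (normr_ge0 y) e1l; have := normr_ge0 y.
  by move: zxy yr'; lra.
move=> /inj E; move: zxy; rewrite -E//; last by rewrite normr0 ltW.
rewrite sub0r -opprD normrN => xy.
have y2x : `|y| <= 2 * `|x|.
  have : `|y| <= `|x + y| + `|x|.
    by rewrite -{1}(addKr x y) (le_trans (ler_normD _ _))// normrN addrC.
  have : e1 * `|y| <= 2^-1 * `|y| by rewrite ler_wpM2r.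
  by move: xy; lra.
rewrite scalerN opprK.
have -> : y + t *: X = (x + y) - (x - t *: X).
  by rowring.
rewrite (le_trans (ler_normB _ _))// (splitr e) mulrDl lerD//.
  rewrite (le_trans xy)//.
  have e1e : e1 <= e / 4 / (1 + `|X|) by rewrite ge_min lexx orbT.
  have xt : `|x| <= (1 + `|X|) * `|t|.
    by rewrite (le_trans xe)// ler_wpM2r// lerD2r ge_min lexx.
  have : e1 * `|y| <= e / 4 / (1 + `|X|) * (2 * ((1 + `|X|) * `|t|)).
    apply: ler_pM => //; first exact: ltW.
    by rewrite (le_trans y2x)// ler_wpM2l.
  move=> /le_trans; apply; rewrite le_eqVlt; apply/orP; left; apply/eqP.
  by field; rewrite gt_eqF.
by rewrite (le_trans xX)// ler_wpM2r// ge_min lexx orbT.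
Qed.

Lemma mulg_coord_differentiable (c1 c2 c3 : chart R d G) a b :
  atlas c1 -> atlas c2 -> atlas c3 ->
  dom c1 a -> dom c2 b -> dom c3 (a * b)%g ->
  differentiable (fun z : g * g =>
    Defs.coord c3 (param c1 z.1 * param c2 z.2)%g)
    (Defs.coord c1 a, Defs.coord c2 b).
Proof.
move=> A1 A2 A3 d1 d2 d3.
have [_ /(_ c1 c2 c3 A1 A2 A3 1%N)[dm _]] := @mulg_smooth R d G.
apply: dm; split => /=; [by exists a|by exists b|].
have [_ _ -> // _ _] := atlas_chart _ A1.
by have [_ _ -> // _ _] := atlas_chart _ A2.
Qed.

Lemma conj_coord_near0 a : \forall y \near (0 :
  g), dom (@chart1 R d G) (a * pa y * a^-1)%g.
Proof.
have [od _ _ _ _] := is_chart1.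
have : (a * pa y * a^-1)%g @[y --> (0 : g)] --> (a * pa 0 * a^-1)%g.
  exact: cvgMg (cvgMg (cvg_cst _) pa1_continuous) (cvg_cst _).
apply; rewrite pa1_0 mulg1 mulgV.
exact: open_nbhs_nbhs (conj od chart1_dom).
Qed.

(** The point [a] need not lie in the chart at 1, so the conjugation is factored as a * pa y
    followed by a^-1, read in charts around [a] and its inverse. The factored map agrees with the
    given one near 0. *)
Lemma conj_differentiable a : differentiable (fun y =>
  co (a * pa y * a^-1)%g) 0.
Proof.
have [c Ac dca] := @atlas_cover R d G a.
have [c' Ac' dca'] := @atlas_cover R d G (a^-1)%g.
have [od _ cK _ _] := atlas_chart _ Ac.
have [_ _ cK' _ _] := atlas_chart _ Ac'.
have D1 : differentiable (fun z : g * g =>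
  Defs.coord c (param c z.1 * pa z.2)%g)
    (Defs.coord c a, 0).
  rewrite -(@chart1_coord R d G).
  apply: mulg_coord_differentiable => //; [exact: chart1_atlas|exact:
    chart1_dom|].
  by rewrite mulg1.
have D2 : differentiable (fun z : g * g => co (param c z.1 * param c' z.2)%g)
    (Defs.coord c a, Defs.coord c' (a^-1)%g).
  apply: mulg_coord_differentiable => //; first exact: chart1_atlas.
  by rewrite mulgV; exact: chart1_dom.
pose F y : g := Defs.coord c (param c (Defs.coord c a) * pa y)%g.
have F0 : F 0 = Defs.coord c a by rewrite /F pa1_0 mulg1 cK.
have DF : differentiable F 0.
  apply: (differentiable_comp (f := fun y : g => (Defs.coord c a, y)) _ D1).
  exact: differentiable_pair.
have DH : differentiable (fun y =>
  co (param c (F y) * param c' (Defs.coord c' (a^-1)%g))%g) 0.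
  rewrite -F0 in D2.
  exact: (differentiable_comp
    (f := fun y : g => (F y, Defs.coord c' (a^-1)%g))
    (differentiable_pair DF (differentiable_cst _ _)) D2).
have E : {near (0 : g), (fun y =>
  co (param c (F y) * param c' (Defs.coord c' (a^-1)%g))%g) =1
    (fun y => co (a * pa y * a^-1)%g)}.
  have : (a * pa y)%g @[y --> (0 : g)] --> (a * pa 0)%g.
    exact: cvgMg (cvg_cst _) pa1_continuous.
  rewrite pa1_0 mulg1 => /(_ _ (open_nbhs_nbhs (conj od dca))) H.
  have {}H : \forall y \near (0 : g), dom c (a * pa y)%g by exact: H.
  by apply: filterS H => y dy; rewrite /F !cK// cK'.
pose L : {linear g -> g} := 'd (fun y =>
  co (param c (F y) * param c' (Defs.coord c' (a^-1)%g))%g) 0.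
suff [] : is_diff (0 : g) (fun y => co (a * pa y * a^-1)%g) L by [].
apply: (is_diffP (L := L)) => e e0; have := differentiable_near DH e0.
have /= E0 := nbhs_singleton E.
apply: filterS2 E => h Eh; rewrite addr0.
by rewrite -Eh -E0.
Qed.

Lemma lie_AdE a : (lie_Ad a : g -> g) = 'd (fun y => co (a * pa y * a^-1)%g) 0.
Proof. by apply/funext => Y; rewrite /lie_Ad deriveE//; exact:
  conj_differentiable. Qed.

Lemma lie_Ad_is_linear a : linear (lie_Ad a : g -> g).
Proof. by rewrite lie_AdE; exact: linearP. Qed.

HB.instance Definition _ a := GRing.isLinear.Build R g g *:%R (lie_Ad a)
  (lie_Ad_is_linear a).

Lemma lie_AdB a X Y : lie_Ad a (X - Y) = lie_Ad a X - lie_Ad a Y.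
Proof. exact: (linearB (lie_Ad a)). Qed.

Lemma lie_AdD a X Y : lie_Ad a (X + Y) = lie_Ad a X + lie_Ad a Y.
Proof. exact: (linearD (lie_Ad a)). Qed.

Lemma lie_AdZ a (k : R) Y : lie_Ad a (k *: Y) = k *: lie_Ad a Y.
Proof. by have := lie_Ad_is_linear a k Y 0; rewrite addr0 => ->;
  rewrite -[in 0](subrr Y) lie_AdB subrr addr0. Qed.

Lemma conj_chart_estimate a (e : R) : 0 < e -> exists2 r : R, 0 < r &
  forall y, `|y| <= r -> exists2 z, `|z - lie_Ad a y| <= e * `|y| &
    (a * pa y * a^-1)%g = pa z.
Proof.
move=> e0; have [_ _ pK _ _] := is_chart1.
have := differentiable_near (conj_differentiable a) e0.
move/(filterS2 _)/(_ (conj_coord_near0 a)) => H.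
have /nbhs_norm0P[r /= r0 Hr] := H _ (fun y p q => conj p q).
exists (r / 2); first by rewrite divr_gt0.
move=> y yr; have /Hr[/=] : `|y| < r.
  by rewrite (le_lt_trans yr)// ltr_pdivrMr// ltr_pMr// ltr1n.
rewrite addr0 pa1_0 mulg1 mulgV {2}/co1 chart1_coord subr0 => zy dz.
exists (co (a * pa y * a^-1)%g); first by rewrite lie_AdE.
by rewrite /pa1 pK.
Qed.

Lemma vel_conj a (q : R -> G) X : vel q X ->
  vel (fun t => (a * q t * a^-1)%g) (lie_Ad a X).
Proof.
move=> qX e e0; have [C C0 HC] := linear_rV_bound (lie_Ad a : {linear g -> g}).
pose e1 := e / 2 / C; have e10 : 0 < e1 by rewrite !divr_gt0.
have C1 : 0 < e1 + `|X| by rewrite ltr_wpDr.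
pose e2 := e / 2 / (e1 + `|X|); have e20 : 0 < e2 by rewrite !divr_gt0.
have [r r0 Hr] := conj_chart_estimate a e20.
apply: filterS (vel_get qX e10 r0) => t [y [yX ye yr qE]].
have [z zy E] := Hr y yr; exists z; last by rewrite qE.
have -> : z - t *: lie_Ad a X = (z - lie_Ad a y) + lie_Ad a (y - t *: X).
  by rewrite lie_AdB lie_AdZ addrA subrK.
rewrite (le_trans (ler_normD _ _))// (splitr e) mulrDl lerD//.
  apply: (le_trans zy); rewrite /e2 mulrAC ler_pdivrMr// -[leRHS]mulrA.
  by apply: ler_wpM2l; [rewrite divr_ge0// ltW|rewrite mulrC].
apply: (le_trans (HC _)); rewrite mulrC -ler_pdivlMr// mulrAC.
exact: yX.
Qed.

Lemma vel_ray X : vel (fun t => pa (t *: X)) X.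
Proof.
move=> e e0; apply: filterE => t; exists (t *: X) => //.
by rewrite subrr normr0 mulr_ge0// ltW.
Qed.

Lemma vel_unique (q : R -> G) X Y : vel q X -> vel q Y -> X = Y.
Proof.
move=> qX qY; have [r r0 inj] := pa1_inj_near.
suff H (e : R) : 0 < e -> `|X - Y| <= e.
  apply/eqP; rewrite -subr_eq0 -normr_le0; apply/ler_addgt0Pl => e e0.
  by rewrite addr0; exact: H.
move=> e0; have e2 : 0 < e / 2 by rewrite divr_gt0.
have := filterI (vel_get qX e2 r0) (vel_get qY e2 r0).
move=> /(_ _)/nbhs_norm0P[s /= s0 Hs].
have /Hs[] : `|s / 2| < s.
  by rewrite ger0_norm ?ltr_pdivrMr// ?ltr_pMr ?ltr1n// divr_ge0// ltW.
set t := s / 2; have t0 : 0 < t by rewrite divr_gt0.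
move=> [x [xX _ xr xE]] [y [yY _ yr yE]].
have xy : x = y by apply: inj => //; rewrite -xE.
have : `|t *: (X - Y)| <= e * `|t|.
  have -> : t *: (X - Y) = (y - t *: Y) - (x - t *: X).
    by rewrite xy; rowring.
  by rewrite (le_trans (ler_normB _ _))// (splitr e) mulrDl lerD.
by rewrite normrZ mulrC ler_pM2r// normr_gt0 gt_eqF.
Qed.

(** Identities for Ad follow from [vel_unique]: both sides are velocities of one and the same
    curve. *)
Lemma lie_Ad1 Y : lie_Ad (1%g : G) Y = Y.
Proof.
apply: vel_unique (vel_conj 1%g (vel_ray Y)) _.
rewrite (_ : (fun t => _) = fun t => pa (t *: Y)); first exact: vel_ray.
by apply/funext => t; rewrite mul1g invg1 mulg1.
Qed.

Lemma lie_AdM a b Y : lie_Ad (a * b)%g Y = lie_Ad a (lie_Ad b Y).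
Proof.
apply: vel_unique (vel_conj _ (vel_ray Y)) _.
have := vel_conj a (vel_conj b (vel_ray Y)); congr vel.
by apply/funext => t; rewrite invgM !mulgA.
Qed.

Lemma lie_AdK a Y : lie_Ad (a^-1)%g (lie_Ad a Y) = Y.
Proof. by rewrite -lie_AdM mulVg lie_Ad1. Qed.

Lemma lie_AdVK a Y : lie_Ad a (lie_Ad (a^-1)%g Y) = Y.
Proof. by rewrite -lie_AdM mulgV lie_Ad1. Qed.

Lemma is_derive_addP (W : normedModType R) (f : R -> W) (t : R) (X : W) :
  is_derive t 1 f X <-> is_derive (0 : R) 1 (fun h : R => f (h + t)) X.
Proof.
by split=> /is_derive1P H; apply/is_derive1P => e e0; move: (H e e0);
  apply: filterS => h; rewrite ?addr0 ?add0r.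
Qed.

Lemma is_derive_linear (W : normedModType R) (L : {linear g -> W})
  (c : R -> g) (t : R) X : is_derive t 1 c X -> is_derive t 1 (L \o c) (L X).
Proof.
move=> dc; have dL : differentiable L (c t).
  by apply: linear_differentiable; exact: continuous_linear_rV.
have := is_derive_comp_diff dc dL.
by rewrite (diff_lin _ (@continuous_linear_rV _ _ _ L)).
Qed.

Lemma is_derive_pair (V W : normedModType R) (f : R -> V) (h : R -> W) (t : R)
  (X : V) (Y : W) : is_derive t 1 f X -> is_derive t 1 h Y ->
  is_derive t 1 (fun r => (f r, h r)) (X, Y).
Proof.
move=> /is_derive1P df /is_derive1P dh; apply/is_derive1P => e e0.
by apply: filterS2 (df e e0) (dh e e0) => r fr hr;
  rewrite prod_normE /= ge_max fr hr.
Qed.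

(** Product rule for a time-dependent linear form: expanding [y r] on the basis leaves products of
    scalar functions. [L'] inherits linearity from [L] by uniqueness of derivatives. *)
Lemma is_derive_family (L : R -> g -> R) (L' : g -> R) (y : R -> g) (t : R) Y :
  (forall r x, L r x = \sum_i x 0 i * L r (delta_mx 0 i)) ->
  (forall x, is_derive t 1 (fun r => L r x) (L' x)) ->
  is_derive t 1 y Y -> is_derive t 1 (fun r => L r (y r)) (L' (y t) + L t Y).
Proof.
move=> linL dL /is_derive_mxP dy.
have -> : L' (y t) = \sum_i y t 0 i * L' (delta_mx 0 i).
  apply: is_derive_unique (dL (y t)) _.
  rewrite (_ : (fun r => _) = \sum_i (fun r => y t 0 i *: L r (delta_mx 0 i))).
    by apply: is_derive_sum => i; exact: is_deriveZ.
  by apply/funext => r; rewrite linL fct_sumE.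
rewrite (_ : (fun r => _) = \sum_i (fun r => y r 0 i * L r (delta_mx 0 i))).
  rewrite [L t Y]linL -big_split/=; apply: is_derive_sum => i.
  have D := @is_deriveM R R (fun r => y r 0 i) (fun r => L r (delta_mx 0 i)) t 1
    _ _ (dy i) (dL _).
  by apply: (is_derive_eq D); rewrite /GRing.scale/= (mulrC (L t _)).
by apply/funext => r; rewrite linL fct_sumE.
Qed.

Lemma vel_is_derive (q : R -> G) X : vel q X ->
  [/\ q 0 = 1%g, is_derive (0 : R) 1 (fun t => co (q t)) X &
      \forall t \near (0 : R), pa (co (q t)) = q t].
Proof.
have [r r0 Hr] := chart1_ball => qX.
have q0 : q 0 = 1%g.
  have /nbhs_singleton[y [_]] := vel_get qX ltr01 r0.
  by rewrite normr0 mulr0 normr_le0 => /eqP-> _ ->; rewrite pa1_0.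
split => //.
  apply/is_derive1P => e e0; apply: filterS (vel_get qX e0 r0) =>
    t [y [yX _ yr qE]].
  rewrite addr0 q0 {2}/co1 chart1_coord subr0 qE.
  by have [_ _ ->] := Hr y yr.
apply: filterS (vel_get qX ltr01 r0) => t [y [_ _ yr ->]].
by have [_ _ ->] := Hr y yr.
Qed.

Lemma co1_1 : co 1%g = 0.
Proof. exact: chart1_coord. Qed.

(* Both sides are the velocity of [pa x * pa (t *: Y)], written
   [(pa x * pa (t *: Y) * (pa x)^-1) * pa x] on the right. *)
Lemma dmulg_chart_Ad : exists2 r : R, 0 < r & forall x Y, `|x| <= r ->
  'd mulg_chart (x, 0) (0, Y) = 'd mulg_chart (0, x) (lie_Ad (pa x) Y, 0).
Proof.
have [r r0 Hr] := mulg_chart_dom_ball; exists r => // x Y xr.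
have r00 : `|0 : g| <= r by rewrite normr0 ltW.
have [q0 dq qE] := vel_is_derive (vel_conj (pa x) (vel_ray Y)).
have := is_derive_comp_diff (f := mulg_chart) (is_derive_affine ((x, 0) :
  g * g) (0, Y) 0).
rewrite scale0r addr0 => /(_ (mulg_chart_differentiable (Hr _ _ xr r00))) D1.
have dx : is_derive (0 : R) 1 (fun=> x) 0 by exact: is_derive_cst.
have D2 := is_derive_comp_diff (f := mulg_chart) (is_derive_pair dq dx).
move: D2; rewrite /= q0 co1_1 =>
  /(_ (mulg_chart_differentiable (Hr _ _ r00 xr))) D2.
apply: is_derive_unique (D1) _; apply: near_eq_is_derive (D2).
apply: filterS qE => t qE /=.
have -> : (x, 0) + t *: ((0, Y) : g * g) = (x, t *: Y).
  by congr pair; rewrite /= ?scaler0 ?addr0 ?add0r.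
by rewrite /mulg_chart/= qE mulgVK.
Qed.

(** By [dmulg_chart_Ad], the vector W = Ad_(pa h) Y - Y solves M_h W = D h, where M_h is the partial
    differential of the product in its first argument at (0, h). As M_h is close to the identity and
    D 0 = 0, the map has the same differential at 0 as [D], which is differentiable because the
    product is twice so. *)
Lemma lie_Ad_differentiable Y : differentiable (fun x => lie_Ad (pa x) Y) 0.
Proof.
pose D x := 'd mulg_chart (x, 0) (0, Y) - 'd mulg_chart (0, x) (Y, 0).
have dl : differentiable (fun x : g => (x, 0 : g)) 0 by exact:
  differentiable_pair.
have dr : differentiable (fun x : g => (0 : g, x)) 0 by exact:
  differentiable_pair.
have dD : differentiable D 0.
  apply: differentiableB.
    exact: (differentiable_comp (g := fun z =>
      'd mulg_chart z (0, Y)) dl (mulg_chart_diff2 _ mulg_chart_dom0)).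
  exact: (differentiable_comp (g := fun z =>
    'd mulg_chart z (Y, 0)) dr (mulg_chart_diff2 _ mulg_chart_dom0)).
have D0 : D 0 = 0 by rewrite /D dmulg_chart0_l dmulg_chart0_r subrr.
pose L : {linear g -> g} := 'd D 0.
suff [] : is_diff (0 : g) (fun x => lie_Ad (pa x) Y) L by [].
apply: (is_diffP (L := L)) => e e0.
have [C C0 HC] := linear_rV_bound L.
pose e2 := Num.min 1 (e / 2); have e20 :
  0 < e2 by rewrite lt_min ltr01 divr_gt0.
have C1 : 0 < 1 + C by rewrite addr_gt0.
(* The bound 1/2 gives |W| <= 2 |D h|; the other one turns e1 |W| into (e / 2) |h|, as |D h| <= (1 +
   C) |h|. *)
pose e1 := Num.min (2^-1) (e / 4 / (1 + C)).
have e10 : 0 < e1 by rewrite lt_min invr_gt0 ltr0n !divr_gt0.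
have [r1 r10 H1] := near_pair_ball (dmulg_chart_near_l e10).
have [r2 r20 H2] := dmulg_chart_Ad.
have near_le (r : R) : 0 < r -> \forall h \near (0 : g), `|h| <= r.
  by move=> r0; apply: nbhs0_le.
have dDL : \forall h \near (0 : g), `|D (h + 0) - D 0 - L h| <= e2 * `|h|.
  exact: differentiable_near.
near=> h; set W := lie_Ad (pa h) Y - Y.
have hr1 : `|h| <= r1 by near: h; exact: near_le.
have hr2 : `|h| <= r2 by near: h; exact: near_le.
have WD : 'd mulg_chart (0, h) (W, 0) = D h.
  transitivity ('d mulg_chart (0, h) (lie_Ad (pa h) Y, 0) - 'd mulg_chart (0,
    h) (Y, 0)).
    have -> : (W, 0) = (lie_Ad (pa h) Y, 0) - (Y, 0) :> g * g.
      by congr pair; rewrite /= ?subr0.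
    exact: (linearB ('d mulg_chart (0, h))).
  exact: (congr1 (fun w => w - 'd mulg_chart (0, h) (Y,
    0)) (esym (H2 h Y hr2))).
have e1W : `|D h - W| <= e1 * `|W|.
  by rewrite -WD; apply: H1 => //; rewrite normr0 ltW.
have DL : `|D h - L h| <= e2 * `|h|.
  have : `|D (h + 0) - D 0 - L h| <= e2 * `|h|.
    by near: h; exact: dDL.
  by rewrite addr0 D0 subr0.
rewrite addr0 pa1_0 lie_Ad1 -/W.
have W2 : `|W| <= 2 * `|D h|.
  have : e1 * `|W| <= 2^-1 * `|W| by rewrite ler_wpM2r// ge_min lexx.
  have : `|W| <= `|D h| + `|D h - W|.
    by rewrite -{1}(subKr (D h) W) (le_trans (ler_normB _ _)).
  by move: e1W; lra.
have DC : `|D h| <= (1 + C) * `|h|.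
  rewrite -(subrK (L h) (D h)) (le_trans (ler_normD _ _))// mulrDl lerD//.
  by rewrite (le_trans DL)// ler_wpM2r// ge_min lexx.
have -> : W - L h = (D h - L h) - (D h - W).
  by rewrite [RHS]addrC opprB addrA subrK.
rewrite (le_trans (ler_normB _ _))// (splitr e) mulrDl lerD//.
  by rewrite (le_trans DL)// ler_wpM2r// ge_min lexx orbT.
apply: (le_trans e1W).
have : e1 * `|W| <= e / 4 / (1 + C) * (2 * ((1 + C) * `|h|)).
  apply: ler_pM => //; first exact: ltW.
    by rewrite ge_min lexx orbT.
  by rewrite (le_trans W2)// ler_wpM2l.
move=> /le_trans; apply; rewrite le_eqVlt; apply/orP; left; apply/eqP.
by field; rewrite gt_eqF.
Unshelve. all: by end_near. Qed.

Lemma vel_Ad (q : R -> G) X Y : vel q X ->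
  is_derive (0 : R) 1 (fun t => lie_Ad (q t) Y) (lie_bracket G X Y).
Proof.
move=> /vel_is_derive[q0 dq qE]; have dA := lie_Ad_differentiable Y.
rewrite /lie_bracket deriveE//.
have := is_derive_comp_diff (f := fun x => lie_Ad (pa x) Y) dq.
rewrite q0 co1_1 => /(_ dA); apply: near_eq_is_derive.
by apply: filterS qE => t /= ->.
Qed.

Lemma left_velocity_Ad_cst (u : R -> G) (t : R) X Y : left_velocity u t X ->
  is_derive t 1 (fun r => lie_Ad (u r) Y) (lie_Ad (u t) (lie_bracket G X Y)).
Proof.
move=> /left_velocityP uX; have D := vel_Ad Y uX; apply/is_derive_addP.
have := is_derive_linear (lie_Ad (u t)) D; congr (is_derive _ _ _).
by apply/funext => h /=; rewrite -lie_AdM mulVKg.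
Qed.

Lemma lie_Ad_sum a Y : lie_Ad a Y = \sum_i Y 0 i *: lie_Ad a (delta_mx 0 i).
Proof. exact: (linear_rV_sum (lie_Ad a)). Qed.

Lemma lie_bracketDr X Y Y' :
  lie_bracket G X (Y + Y') = lie_bracket G X Y + lie_bracket G X Y'.
Proof.
apply: is_derive_unique (vel_Ad _ (vel_ray X)) _.
have := is_deriveD (vel_Ad Y (vel_ray X)) (vel_Ad Y' (vel_ray X)).
by congr (is_derive _ _ _); apply/funext => t; rewrite /= lie_AdD.
Qed.

(** In particular Ad_u y is stationary exactly when y' = - [X, y], which links the momentum equation
    to a conservation law. *)
Lemma left_velocity_Ad (u y : R -> _) (t : R) X (Y : g) :
  left_velocity u t X -> is_derive t 1 y Y ->
  is_derive t 1 (fun r => lie_Ad (u r : G) (y r))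
    (lie_Ad (u t) (lie_bracket G X (y t) + Y)).
Proof.
move=> uX yY; apply/is_derive_mxP => j; rewrite lie_AdD mxE.
apply: (is_derive_family (L := fun r Y => lie_Ad (u r) Y 0 j)
  (L' := fun Y => lie_Ad (u t) (lie_bracket G X Y) 0 j)) => //.
  by move=> r Y'; rewrite lie_Ad_sum summxE; apply: eq_bigr => i _; rewrite mxE.
by move=> Y'; have /is_derive_mxP := left_velocity_Ad_cst Y' uX.
Qed.

(** The increment of the product is v(t)^-1 p(h) v(t) q(h), with p and q the increments of [u] and
    [v]. *)
Lemma left_velocity_mul (u v : R -> G) (t : R) X Y :
  left_velocity u t X -> left_velocity v t Y ->
  left_velocity (fun r => (u r * v r)%g) t (lie_Ad ((v t)^-1)%g X + Y).
Proof.
move=> /left_velocityP uX /left_velocityP vY; apply/left_velocityP.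
have := vel_mul (vel_conj ((v t)^-1)%g uX) vY; congr vel.
by apply/funext => h; rewrite invgK invgM !mulgA mulgK.
Qed.

Lemma left_velocity_inv (u : R -> G) (t : R) X : left_velocity u t X ->
  left_velocity (fun r => ((u r)^-1)%g) t (- lie_Ad (u t) X).
Proof.
move=> /left_velocityP uX; apply/left_velocityP.
have := vel_inv (vel_conj (u t) uX); congr vel.
by apply/funext => h; rewrite mulVKg invgM !invgK.
Qed.

Lemma left_velocity_cst a (t : R) : left_velocity (fun=> a) t 0.
Proof.
apply/left_velocityP => e e0; apply: filterE => h; exists 0; last first.
  by rewrite mulVg pa1_0.
by rewrite scaler0 subrr normr0 mulr_ge0// ltW.
Qed.

(** * Curves staying in a closed subgroup *)

(** Open-closed argument on [0, b] for a property whose bound moves with t: at the supremum of the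
    good times the limit clause gives the property, and the step clause goes beyond. *)
Lemma real_induction (P : R -> Prop) (b : R) : P 0 ->
  (forall t, 0 <= t < b -> P t ->
     exists2 e : R, 0 < e & forall s, t < s <= t + e -> P s) ->
  (forall t, 0 < t <= b -> (forall s, 0 <= s < t -> P s) -> P t) ->
  forall t, 0 <= t <= b -> P t.
Proof.
move=> P0 Pstep Plim t /andP[t0 tb]; have b0 := le_trans t0 tb.
pose A := [set t | 0 <= t <= b /\ forall s, 0 <= s <= t -> P s].
have A0 : A 0 by split=> [|s]; rewrite ?lexx// -eq_le => /eqP <-.
have ubA : ubound A b by move=> s [/andP[]].
have hsA : has_sup A by split; [exists 0|exists b].
set c := sup A; have c0 : 0 <= c by apply: ub_le_sup => //; exists b.
have cb : c <= b by apply: ge_sup => //; exists 0.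
have Plt s : 0 <= s < c -> P s.
  move=> /andP[s0 sc]; have [|u [_ Pu]] := @sup_adherent _ A (c - s) _ hsA.
    by rewrite subr_gt0.
  by rewrite subKr => su; apply: Pu; rewrite s0 ltW.
have Pc : P c.
  have [<-//|c0'] := eqVneq 0 c; apply: Plim => //.
  by rewrite lt_def eq_sym c0' c0.
have Ple s : 0 <= s <= c -> P s.
  move=> /andP[s0]; rewrite le_eqVlt => /predU1P[->//|sc].
  by apply: Plt; rewrite s0.
have [cE|cb'] := eqVneq c b; first by apply: Ple; rewrite t0 cE.
have cltb : c < b by rewrite lt_def eq_sym cb' cb.
have [|e e0 Pe] := Pstep c _ Pc; first by rewrite c0.
suff : A (Num.min b (c + e)).
  move=> /(ub_le_sup (ex_intro _ b ubA)); rewrite -/c leNgt.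
  by rewrite lt_min cltb ltrDl e0.
split=> [|s /andP[s0]].
  by rewrite le_min b0 (addr_ge0 c0 (ltW e0))/= ge_min lexx.
rewrite le_min => /andP[_ se]; have [sc|cs] := leP s c.
  by apply: Ple; rewrite s0.
by apply: Pe; rewrite cs.
Qed.

Lemma closed_ball0_compact (r : R) : compact [set y : g | `|y| <= r].
Proof.
apply: bounded_closed_compact.
  exists r; split; first exact: num_real.
  by move=> M rM y /= yr; rewrite (le_trans yr)// ltW.
by apply: (closed_comp (fun x _ => @norm_continuous _ _ x) (@closed_le _ r)).
Qed.

Lemma pa1_continuous_ball : exists2 r : R, 0 < r &
  forall y, `|y| <= r -> {for y, continuous pa}.
Proof.
have [r r0 H] := chart1_ball; exists r => // y yr.
by have [_ _ _ _] := is_chart1; apply; have [] := H y yr.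
Qed.

(* [tube K e] is the neighbourhood of radius e of K, measured in the chart
   after a right translation by K. *)
Definition tube (K : set G) (e : R) : set G :=
  [set p | exists y k, [/\ `|y| <= e, K k & p = (pa y * k)%g]].

Lemma tube_closed (K : set G) (e : R) : compact K ->
  (forall y, `|y| <= e -> {for y, continuous pa}) -> closed (tube K e).
Proof.
move=> cK cpa; apply: (compact_closed manifold_hausdorff).
have -> : tube K e = (fun z : g * G =>
  (pa z.1 * z.2)%g) @` ([set y | `|y| <= e] `*` K).
  apply/seteqP; split=> [p [y [k [ye Kk ->]]]|_ [[y k] [ye Kk] <-]];
    first by exists (y, k).
  by exists y, k.
have cD := compact_setX (@closed_ball0_compact e) cK.
apply: continuous_compact cD.
apply: continuous_in_subspaceT => -[y k]; rewrite inE => -[/= ye _].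
apply: (@cvgMg _ (nbhs (y, k)) _ (fun z : g * G => pa z.1) snd); last exact:
  cvg_snd.
by apply: (cvg_comp _ _ cvg_fst); exact: cpa.
Qed.

(** If p were outside K, the open complement of K would contain (pa y)^-1 p for all small y; but for
    p = pa y * k this is k. *)
Lemma tube_inter (K : set G) p : closed K ->
  (forall e0 : R, 0 < e0 -> exists2 e : R, e <= e0 & tube K e p) -> K p.
Proof.
move=> cK H; apply: contrapT => NKp.
have : ((pa y)^-1 * p)%g @[y --> (0 : g)] --> ((pa 0)^-1 * p)%g.
  exact: cvgMg (cvgVg pa1_continuous) (cvg_cst _).
rewrite pa1_0 invg1 mul1g => cp.
have : nbhs p (~` K) by apply: open_nbhs_nbhs; split => //; exact: closed_openC.
move=> /cp /nbhs_norm0P[r /= r0 Hr].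
have [|e er [y [k [ye Kk pE]]]] := H (r / 2); first by rewrite divr_gt0.
have : ~ K ((pa y)^-1 * p)%g.
  apply: Hr; rewrite /= (le_lt_trans ye)// (le_lt_trans er)//.
  by rewrite ltr_pdivrMr// ltr_pMr// ltr1n.
by rewrite pE mulKg.
Qed.

Lemma vel_one (q : R -> G) X : vel q X -> q 0 = 1%g.
Proof. by move=> /vel_is_derive[]. Qed.

(* An Euler-step Gronwall estimate: right translations by K do not change the
   tubes, so only the component of the velocity transverse to K counts, and the
   latter is controlled by the distance to K. *)
Lemma stay_in_subgroup (K : set G) (h : R -> G) (eta : R -> g) (C r b : R) :
  compact K -> (forall k k', K k -> K k' -> K (k * k')%g) -> 0 <= C -> 0 < r ->
  K (h 0) -> (forall t, 0 <= t <= b -> left_velocity h t (eta t)) ->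
  (forall t y k, 0 <= t <= b -> `|y| <= r -> K k -> h t = (pa y * k)%g ->
     exists (p : R -> G) (kappa : g), [/\ forall tau, K (p tau), vel p kappa &
       `|lie_Ad k (eta t - kappa)| <= C * `|y|]) ->
  forall t, 0 <= t <= b -> K (h t).
Proof.
move=> cK KM C0 r0 h0 dh Hp t tb; apply: tube_inter.
  exact: (compact_closed manifold_hausdorff).
have [r1 r10 Hr1] := mulg_chart_estimate ltr01;
  have [r2 r20 Hr2] := pa1_continuous_ball.
(* A step from t to s adds 2 |w| <= 2 (beta t / 2 + C beta t) (s - t) = M beta t (s - t) to the
   radius; the summand 1 pays for the differentiability error. *)
pose M := 2 * C + 1; pose r' := Num.min r (Num.min r1 r2).
have M0 : 0 <= M by rewrite /M; lra.
have r'0 : 0 < r' by rewrite !lt_min r0 r10.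
(* With this [e], beta stays below both the validity radius [r'] and the target [e'] on [0, b]. *)
move=> e' e'0; pose e := Num.min (r' / expR (M * b)) (e' / expR (M * b)).
have e0 : 0 < e by rewrite lt_min !divr_gt0 ?expR_gt0.
pose beta s := e * expR (M * s).
have beta0 s : 0 < beta s by rewrite mulr_gt0 ?expR_gt0.
have beta_mono s s' : s <= s' -> beta s <= beta s'.
  by move=> ss'; apply: ler_wpM2l; [exact: ltW|rewrite ler_expR ler_wpM2l].
have beta_r s : s <= b -> beta s <= r'.
  move=> /beta_mono/le_trans; apply; rewrite /beta -ler_pdivlMr ?expR_gt0//.
  by rewrite ge_min lexx.
exists (beta t).
  case/andP: tb => _ /beta_mono/le_trans; apply.
  by rewrite /beta -ler_pdivlMr ?expR_gt0// ge_min lexx orbT.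
move: t tb; apply: real_induction.
- by exists 0, (h 0); split; rewrite ?normr0 ?ltW// pa1_0 mul1g.
- move=> t /andP[t0 tb] [y [k [yb Kk htE]]].
  have /andP[yr /andP[yr1 yr2]] : [&& `|y| <= r, `|y| <= r1 & `|y| <= r2].
    by rewrite -!le_min (le_trans yb)// beta_r// ltW.
  have tb' : 0 <= t <= b by rewrite t0 ltW.
  have [p [kappa [Kp vp kappaC]]] := Hp t y k tb' yr Kk htE.
  have vq := (left_velocityP h t (eta t)).1 (dh t tb').
  (* For tau = s - t, h(s) is pa y times k h(t)^-1 h(s) p(tau)^-1 k^-1 times k p(tau). The middle
     factor has velocity Ad_k (eta t - kappa); the motion along K goes into the last one. *)
  have vv := vel_conj k (vel_mul vq (vel_inv vp)).
  have b20 : 0 < beta t / 2 by rewrite divr_gt0.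
  have /nbhs_norm0P[e1 /= e10 He1] := vel_get vv b20 r10.
  exists (e1 / 2); first by rewrite divr_gt0.
  move=> s /andP[ts se].
  have /He1[w [_ we wr wE]] : `|s - t| < e1.
    rewrite gtr0_norm ?subr_gt0// ltrBlDl (le_lt_trans se)// ltrD2l.
    by rewrite ltr_pdivrMr// ltr_pMr// ltr1n.
  have [z zyw zE] := Hr1 y w yr1 wr.
  exists z, (k * p (s - t))%g; split; [|exact: KM|]; last first.
    by rewrite -zE -wE subrK htE invgM !mulgA !mulgVK mulgK mulgV mul1g.
  have st0 : 0 <= s - t by rewrite subr_ge0 ltW.
  have zle : `|z| <= `|y| + 2 * `|w|.
    rewrite -(subrK w z) -(subrK y (z - w)) (le_trans (ler_normD _ _))//.
    rewrite (_ : 2 * `|w| = `|w| + `|w|); last by ring.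
    rewrite addrA lerD// (le_trans (ler_normD _ _))// addrC lerD//.
    by rewrite addrAC; move: zyw; rewrite mul1r.
  have wle : `|w| <= (beta t / 2 + C * beta t) * (s - t).
    rewrite (le_trans we)// ger0_norm// ler_wpM2r// lerD2l.
    by rewrite (le_trans kappaC)// ler_wpM2l.
  have -> : beta s = beta t * expR (M * (s - t)).
    by rewrite /beta -mulrA -expRD -mulrDr addrC subrK.
  have : beta t * (1 + M * (s - t)) <= beta t * expR (M * (s - t)).
    by rewrite ler_pM2l// expR_ge1Dx.
  apply: le_trans; rewrite (le_trans zle)//.
  rewrite (_ : beta t * _ = beta t + 2 * ((beta t / 2 + C * beta t) * (s - t))).
    by rewrite lerD// ler_wpM2l.
  by rewrite /M; field.
- move=> t /andP[t0 tb] Ht.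
  have tb' : 0 <= t <= b by rewrite ltW.
  have [ch _] := dh t tb'.
  have cl : closed (tube K (beta t)).
    apply: tube_closed => // y yb; apply: Hr2; rewrite (le_trans yb)//.
    by rewrite (le_trans (beta_r t tb))// ge_min ge_min lexx !orbT.
  apply: (@closed_cvg _ _ (t^'-) _ h _ cl); last exact: cvg_at_left_filter.
  near=> s; have [] := Ht s.
    by apply/andP; split; near: s; [exact: nbhs_left_ge|exact: nbhs_left_lt].
  move=> y [k [ys Kk hE]]; exists y, k; split => //.
  by rewrite (le_trans ys)// beta_mono//; near: s; exact: nbhs_left_le.
Unshelve. all: by end_near. Qed.

(** The Gronwall argument with K = {1} and C = 0. *)
Lemma zero_velocity (h : R -> G) (b : R) : h 0 = 1%g ->
  (forall t, 0 <= t <= b -> left_velocity h t 0) ->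
  forall t, 0 <= t <= b -> h t = 1%g.
Proof.
move=> h0 dh; apply: (@stay_in_subgroup [set 1%g] h (fun=> 0) 0 1 b) => //.
- exact: compact_set1.
- by move=> _ _ -> ->; rewrite mulg1.
move=> t y _ _ _ -> _; exists (fun=> 1%g), 0; split=> //.
  by have /left_velocityP := left_velocity_cst 1%g 0; rewrite invg1 mulg1.
by rewrite subrr lie_Ad1 normr0 mul0r.
Qed.

(** * One-parameter subgroups *)

Section OneParameter.
Variables (X : g) (c : R -> G).
Hypothesis cX : one_parameter_subgroup X c.

Lemma one_parameterD r t : c (r + t) = (c r * c t)%g. Proof. exact: cX.1. Qed.

Lemma one_parameter0 : c 0 = 1%g.
Proof. by apply: (@mulgI _ (c 0)); rewrite -one_parameterD addr0 mulg1. Qed.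

Lemma one_parameterN t : c (- t) = ((c t)^-1)%g.
Proof.
by apply: (@mulgI _ (c t)); rewrite -one_parameterD subrr one_parameter0 mulgV.
Qed.

Lemma one_parameter_velocity t : left_velocity c t X.
Proof.
apply/left_velocityP; have /left_velocityP := cX.2; congr vel;
  apply/funext => h.
by rewrite addr0 one_parameter0 invg1 mul1g addrC one_parameterD mulKg.
Qed.

Lemma one_parameter_Ad t : lie_Ad (c t) X = X.
Proof.
have /left_velocityP V := one_parameter_velocity 0.
apply: vel_unique (vel_conj (c t) V) _; move: V; congr vel; apply/funext => h.
rewrite addr0 one_parameter0 invg1 mul1g -one_parameterN -!one_parameterD.
by rewrite addrC addrA addNr add0r.
Qed.

End OneParameter.

(** The velocity of c (c')^-1 is Ad_(c') X - Ad_(c') X = 0; the homomorphism property covers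
    negative times. *)
Lemma one_parameter_unique X (c c' : R -> G) :
  one_parameter_subgroup X c -> one_parameter_subgroup X c' -> c = c'.
Proof.
move=> cX c'X; apply/funext => t.
suff H u : 0 <= u -> c u = c' u.
  have [/H//|/ltW t0] := leP 0 t.
  rewrite -[t]opprK (one_parameterN cX) (one_parameterN c'X) H//.
  by rewrite oppr_ge0.
move=> u0; apply: (@mulIg _ ((c' u)^-1)%g); rewrite mulgV.
apply: (@zero_velocity (fun t => c t * (c' t)^-1)%g u).
- by rewrite (one_parameter0 cX) (one_parameter0 c'X) mulgV.
- move=> r _; have V := left_velocity_mul (one_parameter_velocity cX r)
    (left_velocity_inv (one_parameter_velocity c'X r)).
  by rewrite invgK (one_parameter_Ad c'X) subrr in V.
by rewrite u0 lexx.
Qed.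

(** Each further factor [pa v] costs at most e |v|, whatever the product so far; r / (1 + e) keeps
    the partial products within the radius r. *)
Lemma expg_chart_estimate (e : R) : 0 < e -> exists2 r : R, 0 < r &
  forall (v : g) k, k%:R * `|v| <= r -> exists2 y, `|y - k%:R *:
    v| <= e * (k%:R * `|v|) &
    (pa v ^+ k)%g = pa y.
Proof.
move=> e0; have [r r0 Hr] := mulg_chart_estimate e0.
have e1 : 0 < 1 + e by rewrite addr_gt0.
exists (r / (1 + e)); first by rewrite divr_gt0.
move=> v; elim=> [|k IH] kr.
  by exists 0; rewrite ?scale0r ?subrr ?normr0 ?mul0r ?mulr0// pa1_0.
have kle : k%:R * `|v| <= k.+1%:R * `|v| by rewrite ler_wpM2r// ler_nat.
have [y yk yE] := IH (le_trans kle kr).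
have r1 : r / (1 + e) <= r by rewrite ler_pdivrMr// mulrDr mulr1 lerDl ltW//
  mulr_gt0.
have vr : `|v| <= r.
  by rewrite (le_trans _ (le_trans kr r1))// ler_peMl// ler1n.
have yr : `|y| <= r.
  rewrite -(subrK (k%:R *: v) y) (le_trans (ler_normD _ _))// normrZ.
  rewrite ger0_norm//; move: (le_trans kle kr); rewrite ler_pdivlMr//.
  by move: yk; lra.
have [z zy zE] := Hr y v yr vr; exists z; last by rewrite expgSr yE zE.
have -> : z - k.+1%:R *: v = (z - y - v) + (y - k%:R *: v).
  by rewrite -natr1; rowring.
rewrite (le_trans (ler_normD _ _))// -natr1 mulrDl mul1r mulrDr addrC lerD//.
Qed.

Lemma ultra_fmap (T U : Type) (F : set_system T) (f : T -> U) :
  UltraFilter F -> UltraFilter (f @ F).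
Proof.
move=> FU; split=> [|H HP fH]; first exact: fmap_proper_filter.
apply/seteqP; split=> [A HA|]; last exact: fH.
have [//|FC] := in_ultra_setVsetC (f @^-1` A) FU.
have HC : H (~` A) by exact: fH.
have : H (A `&` ~` A) by exact: filterI.
by rewrite setICr => /filter_not_empty.
Qed.

Hypothesis compactG : compact [set: G].

Let euler_step (X : g) (n : nat) : g := n.+1%:R^-1 *: X.
(** Euler polygon for c' = c X, with time rounded down to a multiple of 1 / (n + 1). *)
Let euler_path (X : g) (t : R) (n : nat) :
  G := (pa (euler_step X n) ^+ Num.truncn (t * n.+1%:R))%g.

(* The homomorphism property only uses that the one-step displacement tends to
   1, so an ultralimit of discrete one-parameter semigroups is a homomorphism,
   whether or not these converge. *)
Lemma semigroup_exists X : exists c : R -> G,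
  (forall r t : R, 0 <= r -> 0 <= t -> c (r + t) = (c r * c t)%g) /\
  (forall e : R, 0 < e -> exists2 r : R, 0 < r & forall t : R, 0 <= t <= r ->
     exists2 y : g, `|y - t *: X| <= e * t & c t = pa y).
Proof.
(* Along an ultrafilter finer than n -> oo, compactness of G makes the paths converge at all times t
   at once. *)
have [U [UU eU]] := @ultraFilterLemma nat \oo _.
have UP : ProperFilter U by exact: ultra_proper.
have exc t : exists p : G, euler_path X t @ U --> p.
  have := compactG; rewrite compact_ultra =>
    /(_ (euler_path X t @ U) (ultra_fmap _ UU) filterT).
  by move=> [p [_ pP]]; exists p.
pose c t := sval (cid (exc t)).
have cP t : euler_path X t @ U --> c t by exact: svalP (cid (exc t)).
have cst_cvg (f : nat -> G) t p : f @ U --> p ->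
  (\forall n \near U, f n = euler_path X t n) ->
    c t = p.
  move=> fp fE; apply: (cvg_unique manifold_hausdorff (F :=
    euler_path X t @ U)).
    exact: cP.
  by move=> V /fp; rewrite /= => fV; apply: filterS2 fE fV => n /= <-.
have step0 : euler_step X n @[n --> U] --> (0 : g).
  have H : euler_step X n @[n --> \oo] --> (0 : R) *: X by apply: cvgZ;
    [exact: cvg_harmonic|exact: cvg_cst].
  by rewrite scale0r in H; move=> V /H; exact: eU.
have pstep : pa (euler_step X n) @[n --> U] --> (1%g : G).
  by rewrite -pa1_0; apply: (cvg_comp _ _ step0); exact: pa1_continuous.
exists c; split.
  move=> r t r0 t0.
  (* Rounding defect: floors are additive up to 0 or 1, and one extra step tends to 1. *)
  pose b n : nat := (Num.truncn ((r + t) * n.+1%:R) -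
    (Num.truncn (r * n.+1%:R) + Num.truncn (t * n.+1%:R)))%N.
  have bE n : Num.truncn ((r + t) * n.+1%:R) =
      (Num.truncn (r * n.+1%:R) + Num.truncn (t * n.+1%:R) + b n)%N /\ (b n <=
        1)%N.
    have /truncn_itv/andP[r1 r2] : 0 <= r * n.+1%:R by rewrite mulr_ge0.
    have /truncn_itv/andP[t1 t2] : 0 <= t * n.+1%:R by rewrite mulr_ge0.
    have rt0 : 0 <= (r + t) * n.+1%:R by rewrite mulr_ge0// addr_ge0.
    have le1 : (Num.truncn (r * n.+1%:R) + Num.truncn (t * n.+1%:R) <=
        Num.truncn ((r + t) * n.+1%:R))%N.
      by rewrite truncn_ge_nat// natrD mulrDl lerD.
    split; first by rewrite /b subnKC.
    rewrite /b leq_subLR addn1 -ltnS truncn_lt_nat// -addSn -addnS natrD mulrDl.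
    exact: ltrD.
  have bcvg : (pa (euler_step X n) ^+ b n)%g @[n --> U] --> (1%g : G).
    move=> V V1; suff : \forall n \near U,
      V (pa (euler_step X n) ^+ b n)%g by [].
    have pV : \forall n \near U, V (pa (euler_step X n)) by exact: pstep.
    apply: filterS pV => n pV.
    have [_] := bE n; case: (b n) => [|[|//]] _ /=.
      by rewrite expg0; exact: nbhs_singleton.
    by rewrite expg1.
  apply: (cst_cvg (fun n => euler_path X r n * euler_path X t n * (pa
    (euler_step X n) ^+ b n))%g).
    by rewrite -[(c r * c t)%g]mulg1; exact: cvgMg (cvgMg (cP r) (cP t)) bcvg.
  by apply: filterE => n; rewrite /euler_path (bE n).1 !expgnDr.
move=> e e0; have C0 : 0 < 2 * (1 + `|X|) by rewrite mulr_gt0// ltr_wpDr.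
(* Half of e t pays for the power estimate, the other half for rounding t down. *)
pose e' := e / (2 * (1 + `|X|)); have e'0 : 0 < e' by rewrite divr_gt0.
have [r r0 Hr] := expg_chart_estimate e'0;
  have [r2 r20 Hr2] := pa1_continuous_ball.
have D0 : 0 < 1 + `|X| by rewrite ltr_wpDr.
have D1 : 0 < e + `|X| by rewrite ltr_wpDr.
exists (Num.min (r / (1 + `|X|)) (r2 / (e + `|X|)));
  first by rewrite lt_min !divr_gt0.
move=> t /andP[t0]; rewrite le_min => /andP[tr tr2].
(* At t = 0 the tolerance e t vanishes and leaves no room for the rounding error; the path is then
   constant. *)
have [tE|tn0] := eqVneq t 0.
  exists 0; first by rewrite tE scale0r subrr normr0 mulr0.
  rewrite pa1_0; apply: (cst_cvg (fun=> 1%g)); first exact: cvg_cst.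
  by apply: filterE => n; rewrite /euler_path tE mul0r truncn0 expg0.
have tgt0 : 0 < t by rewrite lt_def tn0.
pose D := [set y : g | `|y - t *: X| <= e * t].
have Dr2 y : D y -> `|y| <= r2.
  rewrite /D/= => yD; rewrite -(subrK (t *: X) y) (le_trans (ler_normD _ _))//.
  by move: tr2; rewrite ler_pdivlMr// normrZ (ger0_norm t0); move: yD; lra.
have cD : compact D.
  apply: bounded_closed_compact.
    exists r2; split; first exact: num_real.
    by move=> M rM y /= /Dr2 yr; rewrite (le_trans yr)// ltW.
  apply: (closed_comp (f := fun y => `|y - t *: X|) _ (@closed_le _ (e * t))).
  move=> y _; have D' : differentiable (fun y : g => y - t *: X) y by [].
  exact: cvg_norm (differentiable_continuous D').
have clD : closed (pa @` D).
  apply: (compact_closed manifold_hausdorff); apply: continuous_compact cD.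
  by apply: continuous_in_subspaceT => y; rewrite inE => /Dr2; exact: Hr2.
have [y yD yE] : (pa @` D) (c t); last by exists y.
apply: (@closed_cvg _ _ U _ (euler_path X t) _ clD); last exact: cP.
have lim0 : \forall n \near U, n.+1%:R^-1 * `|X| <= e * t / 2.
  have H : n.+1%:R^-1 * `|X| @[n --> \oo] --> 0 * `|X| by apply: cvgMl; exact:
    cvg_harmonic.
  rewrite mul0r in H; apply: eU.
  have /cvgrPdist_le/(_ (e * t / 2)) := H; rewrite !divr_gt0 ?mulr_gt0// =>
    /(_ isT).
  by apply: filterS => n; rewrite sub0r normrN; apply: le_trans; exact:
    ler_norm.
apply: filterS lim0 => n nX; pose k := Num.truncn (t * n.+1%:R).
have n0 : 0 < n.+1%:R :> R by rewrite ltr0n.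
have /truncn_itv/andP[k1 k2] : 0 <= t * n.+1%:R by rewrite mulr_ge0.
rewrite -/k in k1 k2.
have normv : `|euler_step X n| = n.+1%:R^-1 * `|X|.
  by rewrite /euler_step normrZ ger0_norm// invr_ge0 ltW.
have kt : k%:R * `|euler_step X n| <= t * `|X|.
  by rewrite normv mulrA ler_wpM2r// ler_pdivrMr.
have [|y yk yE] := Hr (euler_step X n) k.
  rewrite (le_trans kt)//; move: tr; rewrite ler_pdivlMr//.
  by have := normr_ge0 X; move: t0; lra.
exists y; last by rewrite /euler_path -/k yE.
rewrite /D/=; have -> : y - t *: X = (y - k%:R *:
  euler_step X n) - (t - k%:R / n.+1%:R) *: X.
  by rewrite /euler_step scalerA scalerBl opprB addrA subrK.
rewrite (le_trans (ler_normB _ _))// (splitr e) mulrDl lerD//.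
  rewrite (le_trans yk)//; apply: (@le_trans _ _ (e' * (t * `|X|))).
    by rewrite ler_wpM2l// ltW.
  rewrite /e' (_ : _ * (t * `|X|) = e / 2 * t * (`|X| / (1 + `|X|)));
    last first.
    by field; rewrite gt_eqF.
  by rewrite ger_pMr ?mulr_gt0 ?divr_gt0// ler_pdivrMr// mul1r lerDr.
rewrite normrZ ger0_norm; last by rewrite subr_ge0 ler_pdivrMr.
rewrite mulrAC in nX; rewrite (le_trans _ nX)// ler_wpM2r// lerBlDr.
by rewrite -[X in X + _]mul1r -mulrDl addrC natr1 ler_pdivlMr// ltW.
Qed.

Lemma one_parameter_exists X : exists c, one_parameter_subgroup X (c : R -> G).
Proof.
have [f [fD fX]] := semigroup_exists X.
have f0 : f 0 = 1%g.
  have := fD 0 0 (lexx _) (lexx _); rewrite addr0 => E.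
  by apply: (@mulgI _ (f 0)); rewrite -E mulg1.
have fC r t : 0 <= r -> 0 <= t -> (f r * f t = f t * f r)%g.
  by move=> r0 t0; rewrite -!fD// addrC.
(* With t+ and t- the positive and negative parts of t, c t = f(t+) f(t-)^-1. As the values of [f]
   commute, such a quotient depends only on the difference of the two times. *)
pose pos (t : R) := Num.max t 0; pose c t := (f (pos t) * (f (pos (- t)))^-1)%g.
have pos0 t : 0 <= pos t by rewrite le_max lexx orbT.
have posE t : pos t - pos (- t) = t.
  by rewrite /pos; have [t0|t0] := leP t 0; have [t0'|t0'] := leP (- t) 0; lra.
have quot (a b a' b' : R) : 0 <= a -> 0 <= b -> 0 <= a' -> 0 <= b' ->
  a + b' = a' + b ->
    (f a * (f b)^-1 = f a' * (f b')^-1)%g.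
  move=> a0 b0 a'0 b'0 E; apply: (@mulIg _ (f b * f b')%g).
  by rewrite mulgA mulgVK -(fD a b')// E (fC b b')// mulgA mulgVK fD.
have cD r t : c (r + t) = (c r * c t)%g.
  rewrite /c -[RHS]mulgA (mulgA (f (pos (- r)))^-1%g).
  have comm : ((f (pos (- r)))^-1 * f (pos t) =
    f (pos t) * (f (pos (- r)))^-1)%g.
    by apply: (@mulgI _ (f (pos (- r)))); rewrite mulVKg mulgA fC// mulgK.
  rewrite comm -(mulgA (f (pos t))) -invgM -fD// mulgA -fD//.
  apply: quot; rewrite ?addr_ge0//.
  by have := posE r; have := posE t; have := posE (r + t); lra.
have c0 : c 0 = 1%g by rewrite /c oppr0 /pos max_l// f0 invg1 mulg1.
exists c; split => //; apply/left_velocityP.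
suff H : vel c X.
  by move: H; congr vel; apply/funext => h; rewrite addr0 c0 invg1 mul1g.
(* [f] is controlled for t >= 0 only; the ray fills in t < 0 so that [vel_inv] applies. Then [c t]
   is [q t] for t >= 0 and the inverse of q(- t) for t < 0. *)
pose q t := if 0 <= t then f t else pa (t *: X).
have vq : vel q X.
  move=> e e0; have [r r0 Hr] := fX e e0; apply/nbhs_norm0P; exists r =>
    //= t tr.
  rewrite /q; case: ifPn => [t0|_]; last first.
    by exists (t *: X); rewrite ?subrr ?normr0 ?mulr_ge0// ltW.
  rewrite ger0_norm//; apply: Hr; rewrite t0 ltW//.
  by move: tr; rewrite /= ger0_norm.
move=> e e0; have /nbhs_norm0P[r /= r0 Hr] := vel_inv vq e0.
have /nbhs_norm0P[r' /= r'0 Hr'] := vq e e0.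
apply/nbhs_norm0P; exists (Num.min r r') => /=; first by rewrite lt_min r0.
move=> t /=; rewrite lt_min => /andP[tr tr'].
have [t0|t0] := leP 0 t.
  have [y yt yE] := Hr' t tr'; exists y => //;
    rewrite -yE /q t0 /c /pos max_l//.
  by rewrite max_r ?oppr_le0// f0 invg1 mulg1.
have [|y yt yE] := Hr (- t); first by rewrite /= normrN.
exists y; first by rewrite normrN scalerN scaleNr opprK in yt.
by rewrite -yE /q oppr_ge0 ltW// /c /pos max_r ?ltW// max_l ?oppr_ge0 ?ltW//
  f0 mul1g.
Qed.

Lemma vel_scale (q : R -> G) X k : vel q X -> vel (fun t => q (k * t)) (k *: X).
Proof.
move=> qX e e0; have k0 : 0 < `|k| + 1 by rewrite ltr_wpDl.
have e'0 : 0 < e / (`|k| + 1) by rewrite divr_gt0.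
have /nbhs_norm0P[r /= r0 Hr] := qX _ e'0.
apply/nbhs_norm0P; exists (r / (`|k| + 1)) => /=; first by rewrite divr_gt0.
move=> t; rewrite /= ltr_pdivlMr// => tr.
have [|y yt yE] := Hr (k * t).
  rewrite /= normrM (le_lt_trans _ tr)// mulrC ler_wpM2l//.
  by rewrite lerDl.
exists y => //; rewrite scalerA mulrC (le_trans yt)// normrM mulrA ler_wpM2r//.
by rewrite mulrAC ler_pdivrMr// ler_pM2l// lerDl.
Qed.

Lemma one_parameter_scale X (c : R -> G) k : one_parameter_subgroup X c ->
  one_parameter_subgroup (k *: X) (fun t => c (k * t)).
Proof.
move=> cX; split=> [r t|]; first by rewrite mulrDr (one_parameterD cX).
have /left_velocityP/(vel_scale k) V := cX.2.
apply/left_velocityP; move: V; congr vel; apply/funext => h.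
by rewrite mulr0 !addr0.
Qed.

(** Existence makes the choice in [lie_exp] succeed; uniqueness identifies its value at t X with
    that of the rescaled subgroup of X. *)
Lemma lie_expP X : one_parameter_subgroup X (fun t => lie_exp G (t *: X)).
Proof.
have [c cX] := one_parameter_exists X.
rewrite (_ : (fun t => _) = c)//; apply/funext => t.
rewrite /lie_exp; case: xgetP => [_ _ [c' c'X <-]|/(_ (c t)) []].
  by rewrite (one_parameter_unique c'X (one_parameter_scale t cX)) mulr1.
exists (fun r => c (t * r)); first exact: one_parameter_scale.
by rewrite mulr1.
Qed.

Lemma velP (q : R -> G) X : vel q X <-> q 0 = 1%g /\ left_velocity q 0 X.
Proof.
split=> [qX|[q0 /left_velocityP]].
  have q0 := vel_one qX; split=> //; apply/left_velocityP; move: qX.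
  by congr vel; apply/funext => h; rewrite addr0 q0 invg1 mul1g.
by congr vel; apply/funext => h; rewrite addr0 q0 invg1 mul1g.
Qed.

Lemma left_velocity_opp (u : R -> G) t X :
  left_velocity u (- t) X -> left_velocity (fun r => u (- r)) t (- X).
Proof.
move=> /left_velocityP /(vel_scale (-1)) V; apply/left_velocityP.
move: V; rewrite scaleN1r; congr vel; apply/funext => h.
by rewrite opprD mulN1r.
Qed.

Lemma lie_bracketNl X Y : lie_bracket G (- X) Y = - lie_bracket G X Y.
Proof.
rewrite /lie_bracket !deriveE ?lie_Ad_differentiable//.
- exact: (linearN ('d (fun x : g => lie_Ad (pa x) Y) 0)).
- exact: lie_Ad_differentiable.
- exact: lie_Ad_differentiable.
Qed.

(** Derivative at t = 0 of Ad_a Ad_(pa (t X)) Y = Ad_(a pa (t X) a^-1) Ad_a Y. *)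
Lemma lie_Ad_bracket a X Y :
  lie_Ad a (lie_bracket G X Y) = lie_bracket G (lie_Ad a X) (lie_Ad a Y).
Proof.
have D := vel_Ad (lie_Ad a Y) (vel_conj a (vel_ray X)).
apply: is_derive_unique (is_derive_linear (lie_Ad a) (vel_Ad Y (vel_ray X))) _.
move: D; congr (is_derive _ _ _); apply/funext => t /=.
by rewrite -!lie_AdM mulgVK.
Qed.

(* The case of the inverse follows from the direct one: if w = Ad^-1 z then
   |w - z| = |Ad w - w| <= C |y| |w|, and |w| <= 2 |z| for small y. *)
Lemma lie_AdV_near : exists C r : R, [/\ 0 <= C, 0 < r &
  forall y z, `|y| <= r ->
  `|lie_Ad ((pa y)^-1)%g z - z| <= C * `|y| * `|z|].
Proof.
have H i : exists C r : R, [/\ 0 <= C, 0 < r & forall y : g, `|y| <= r ->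
    `|lie_Ad (pa y) (delta_mx 0 i) - delta_mx 0 i| <= C * `|y|].
  have dA := lie_Ad_differentiable (delta_mx 0 i).
  have [C C0 HC] := linear_rV_bound ('d (fun x : g =>
    lie_Ad (pa x) (delta_mx 0 i)) 0).
  have /nbhs_norm0P[r /= r0 Hr] := differentiable_near dA ltr01.
  exists (1 + C), (r / 2); split;
    [by rewrite addr_ge0// ltW|by rewrite divr_gt0|].
  move=> y yr; have /Hr : `|y| < r.
    by rewrite (le_lt_trans yr)// ltr_pdivrMr// ltr_pMr// ltr1n.
  rewrite addr0 pa1_0 lie_Ad1 => yA; rewrite mulrDl.
  set D := 'd _ _ in HC yA; rewrite -(subrK (D y) (_ - delta_mx 0 i)).
  by rewrite (le_trans (ler_normD _ _))// lerD.
have Hfun i : {p : R * R | [/\ 0 <= p.1, 0 < p.2 & forall y : g, `|y| <= p.2 ->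
    `|lie_Ad (pa y) (delta_mx 0 i) - delta_mx 0 i| <= p.1 * `|y|]}.
  by apply: cid; have [C [r Hr]] := H i; exists (C, r).
pose C := \sum_i (sval (Hfun i)).1.
have C0 : 0 <= C by apply: sumr_ge0 => i _; case: (svalP (Hfun i)).
pose r := \big[Num.min/1]_i (sval (Hfun i)).2.
have r0 : 0 < r.
  by apply/bigmin_gtP; split=> // i _; case: (svalP (Hfun i)).
have C1 : 0 < 2 * C + 1 by rewrite ltr_wpDl// mulr_ge0.
exists (2 * C), (Num.min r (2 * C + 1)^-1); split; first by rewrite mulr_ge0.
  by rewrite lt_min r0 invr_gt0.
move=> y z; rewrite le_min => /andP[yr yC].
set w := lie_Ad _ z; have zE : z = lie_Ad (pa y) w by rewrite lie_AdVK.
have wz : `|w - z| <= C * `|y| * `|w|.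
  rewrite distrC zE lie_Ad_sum {2}[w]row_sum_delta -sumrB.
  rewrite (eq_bigr (fun i => w 0 i *:
    (lie_Ad (pa y) (delta_mx 0 i) - delta_mx 0 i))); last first.
    by move=> i _; rewrite scalerBr.
  rewrite (le_trans (sum_norm_le _ _))// mulrC ler_wpM2r//
    mulr_suml ler_sum// => i _.
  have [_ _] := svalP (Hfun i); apply; rewrite (le_trans yr)//.
  exact: bigmin_le_cond.
have wz2 : `|w| <= 2 * `|z|.
  have : `|w| <= `|w - z| + `|z| by rewrite -{1}(subrK z w) ler_normD.
  have : C * `|y| * `|w| <= 2^-1 * `|w|.
    rewrite ler_wpM2r//; have :
      (2 * C + 1) * `|y| <= 1 by rewrite mulrC -ler_pdivlMr// mul1r.
    by have := normr_ge0 y; lra.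
  by move: wz; lra.
rewrite (le_trans wz)// (_ : 2 * C * `|y| * `|z| = C * `|y| * (2 * `|z|));
  last by ring.
by rewrite ler_wpM2l// mulr_ge0.
Qed.

End Chart.

(** * Lie subgroups *)

Section Morphism.
Variables (R : realType) (m d : nat) (H : lieGroupType R m) (G :
  lieGroupType R d).
Variable f : H -> G.
Hypothesis smoothf : smooth_map f.
Hypothesis fM : {morph f : x y / (x * y)%g}.

Lemma morph1 : f 1%g = 1%g.
Proof. by apply: (@mulgI _ (f 1%g)); rewrite -fM !mulg1. Qed.

Lemma morphV x : f (x^-1)%g = ((f x)^-1)%g.
Proof. by apply: (@mulgI _ (f x)); rewrite -fM !mulgV morph1. Qed.

Lemma morph_differentiable : differentiable (fun x => co1 (f (pa1 H x))) 0.
Proof.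
have [_ /(_ _ _ chart1_atlas chart1_atlas 1%N) [df _]] := smoothf.
apply: df; exists 1%g; last exact: chart1_coord.
by split; [exact: chart1_dom|rewrite /= morph1; exact: chart1_dom].
Qed.

Lemma vel_morph (q : R -> H) X : vel q X -> vel (f \o q) (tangent1 f X).
Proof.
move=> qX; have [q0 dq qE] := vel_is_derive qX.
have [_ [cq _]] := (velP q X).1 qX.
apply/velP; split; first by rewrite /= q0 morph1.
split.
  by apply: continuous_comp; [exact: cq|have [cf _] := smoothf; exact: cf].
rewrite /tangent1 (deriveE _ morph_differentiable) /= q0 morph1 invg1.
have := is_derive_comp_diff (f := fun x => co1 (f (pa1 H x))) dq.
rewrite q0 co1_1 => /(_ morph_differentiable); apply: near_eq_is_derive.
by apply: filterS qE => t /= ->; rewrite mul1g.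
Qed.

Lemma lie_Ad_tangent1 h X :
  lie_Ad (f h) (tangent1 f X) = tangent1 f (lie_Ad h X).
Proof.
apply: (vel_unique (vel_conj (f h) (vel_morph (vel_ray H X)))).
have := vel_morph (vel_conj h (vel_ray H X)); congr vel.
by apply/funext => t /=; rewrite !fM morphV.
Qed.

End Morphism.

Section Subgroup.
Variables (R : realType) (d : nat) (G : lieGroupType R d).
Variables (A : set G) (W : {vspace 'rV[R]_d}).
Hypothesis subA : lie_subgroup A W.

Lemma lie_subgroup1 : A 1%g.
Proof.
have [m [H [f [_ fM _ _ [-> _]]]]] := subA.
by exists 1%g => //; exact: morph1.
Qed.

Lemma lie_subgroupM x y : A x -> A y -> A (x * y)%g.
Proof.
have [m [H [f [_ fM _ _ [-> _]]]]] := subA.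
by move=> [h _ <-] [k _ <-]; exists (h * k)%g.
Qed.

Lemma lie_subgroupV x : A x -> A (x^-1)%g.
Proof.
have [m [H [f [_ fM _ _ [-> _]]]]] := subA.
by move=> [h _ <-]; exists (h^-1)%g => //; exact: morphV.
Qed.

Lemma lie_subgroup_Ad x Y : A x -> Y \in W -> lie_Ad x Y \in W.
Proof.
have [m [H [f [sf fM _ _ [-> WE]]]]] := subA.
move=> [h _ <-]; have EW Z :
  (Z \in W) = range (tangent1 f) Z :> Prop by rewrite -WE.
rewrite !EW => -[X _ <-]; exists (lie_Ad h X) => //.
by rewrite lie_Ad_tangent1.
Qed.

(** The image of a ray of the abstract group: it is differentiable in G even if [A] does not carry
    the induced topology. *)
Lemma lie_subgroup_curve X : X \in W -> exists2 p : R ->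
  G, (forall t, A (p t)) & vel p X.
Proof.
have [m [H [f [sf fM _ _ [-> WE]]]]] := subA.
have EW Z : (Z \in W) = range (tangent1 f) Z :> Prop by rewrite -WE.
rewrite EW => -[v _ <-].
exists (f \o (fun t => pa1 H (t *: v))); first by move=> t; eexists.
exact: vel_morph (vel_ray H v).
Qed.

End Subgroup.


(** * Orthogonal projections and the Hamiltonian *)

Section ScalarProduct.
Variables (R : realType) (d : nat) (B : 'rV[R]_d -> 'rV[R]_d -> R).
Hypothesis scalarB : scalar_product B.
Local Notation g := 'rV[R]_d.
Implicit Types (x y z w : g) (U W : {vspace g}) (k : R).

Lemma formC x y : B x y = B y x. Proof. by have [] := scalarB. Qed.

Lemma formDl x y z : B (x + y) z = B x z + B y z.
Proof. by have [/(_ 1 x y z)] := scalarB; rewrite scale1r mul1r. Qed.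

Lemma form0l z : B 0 z = 0.
Proof. by have := formDl 0 0 z; rewrite addr0; lra. Qed.

Lemma formZl k x z : B (k *: x) z = k * B x z.
Proof. by have [/(_ k x 0 z)] := scalarB; rewrite addr0 form0l addr0. Qed.

Lemma formNl x z : B (- x) z = - B x z.
Proof. by rewrite -scaleN1r formZl mulN1r. Qed.

Lemma formBl x y z : B (x - y) z = B x z - B y z.
Proof. by rewrite formDl formNl. Qed.

Lemma formDr z x y : B z (x + y) = B z x + B z y.
Proof. by rewrite formC formDl !(formC z). Qed.

Lemma form0r z : B z 0 = 0. Proof. by rewrite formC form0l. Qed.

Lemma formZr z k x : B z (k *: x) = k * B z x.
Proof. by rewrite formC formZl (formC z). Qed.

Lemma formBr z x y : B z (x - y) = B z x - B z y.
Proof. by rewrite formC formBl !(formC z). Qed.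

Lemma form_suml (J : Type) (r : seq J) (P : pred J) (F : J -> g) z :
  B (\sum_(i <- r | P i) F i) z = \sum_(i <- r | P i) B (F i) z.
Proof. by elim/big_rec2: _ => [|i a b _ <-]; rewrite ?form0l// formDl. Qed.

Lemma form_sumr (J : Type) (r : seq J) (P : pred J) (F : J -> g) z :
  B z (\sum_(i <- r | P i) F i) = \sum_(i <- r | P i) B z (F i).
Proof. by rewrite formC form_suml; apply: eq_bigr => i _; rewrite formC. Qed.

Lemma form_ge0 x : 0 <= B x x.
Proof.
have [-> | x0] := eqVneq x 0; first by rewrite form0l.
by have [_ _ /(_ x x0)/ltW] := scalarB.
Qed.

Lemma form_eq0 x : B x x = 0 -> x = 0.
Proof.
have [->//| x0] := eqVneq x 0.
by have [_ _ /(_ x x0)] := scalarB; move=> /gt_eqF/eqP.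
Qed.

Lemma form_ext x y : (forall z, B x z = B y z) -> x = y.
Proof.
by move=> H; apply/eqP; rewrite -subr_eq0; apply/eqP/form_eq0;
  rewrite formBl H subrr.
Qed.

Lemma is_derive_form (f h : R -> g) (t : R) X Y :
  is_derive t 1 f X -> is_derive t 1 h Y ->
  is_derive t 1 (fun r => B (f r) (h r)) (B X (h t) + B (f t) Y).
Proof.
move=> df dh; apply: (is_derive_family (L := fun r =>
  B (f r)) (L' := B X)) => //.
  move=> r x; rewrite {1}[x]row_sum_delta form_sumr.
  by apply: eq_bigr => i _; rewrite formZr.
move=> x; rewrite -[B X x]add0r.
apply: (is_derive_family (L := fun r y => B y x) (L' := fun=> 0)) => //.
  move=> _ y; rewrite {1}[y]row_sum_delta form_suml.
  by apply: eq_bigr => i _; rewrite formZl.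
by move=> y; exact: is_derive_cst.
Qed.

Lemma orth_proj_eq (S : set g) x y : (forall u v, S u -> S v -> S (u - v)) ->
  S y -> (forall w, S w -> B (x - y) w = 0) -> orth_proj B S x = y.
Proof.
move=> SB Sy yS; rewrite /orth_proj; case: xgetP => [z _ [Sz zS]|/(_ y)[]//].
apply/eqP; rewrite -subr_eq0; apply/eqP/form_eq0.
have -> : B (z - y) (z - y) = B (x - y) (z - y) - B (x - z) (z - y).
  by rewrite -formBl; congr (B _ _); rewrite opprB [RHS]addrC addrA subrK.
by rewrite yS ?zS ?subrr//; exact: SB.
Qed.

Lemma orth_decomp_span (s : seq g) x :
  exists2 y, y \in << s >>%VS & forall w, w \in << s >>%VS -> B (x - y) w = 0.
Proof.
elim: s x => [|v s IH] x.
  exists 0; first exact: mem0v.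
  by move=> w; rewrite span_nil memv0 => /eqP ->; rewrite form0r.
have [y ys yx] := IH x; have [v0 v0s v0v] := IH v.
(* The list may be dependent: if v lies in the span of s then v1 = 0, and division by zero gives c =
   0. *)
pose v1 := v - v0; pose c := B (x - y) v1 / B v1 v1.
exists (y + c *: v1).
  rewrite span_cons memvD//; first by rewrite (subvP (addvSr _ _)).
  rewrite memvZ// memvB//; last by rewrite (subvP (addvSr _ _)).
  by rewrite (subvP (addvSl _ _))// memv_line.
move=> w; rewrite span_cons => /memv_addP[_ /vlineP[k ->] [w' w's ->]].
rewrite opprD addrA formBl formZl.
have w'E : B (x - y) w' - c * B v1 w' = 0 by rewrite yx// v0v// mulr0 subr0.
have v0E : B (x - y) v0 - c * B v1 v0 = 0 by rewrite yx// v0v// mulr0 subr0.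
have v1E : B (x - y) v1 - c * B v1 v1 = 0.
  have [v10|v10] := eqVneq (B v1 v1) 0.
    by rewrite (form_eq0 v10) !form0r mulr0 subrr.
  by rewrite /c mulfVK ?subrr.
have vE : v = v1 + v0 by rewrite /v1 subrK.
clearbody v1; rewrite {}vE.
rewrite !formDr !formZr !formDr.
have -> (a a0 a1 b b0 b1 : R) : k * (a1 + a0) + a - c * (k * (b1 + b0) + b) =
  k * ((a1 - c * b1) + (a0 - c * b0)) + (a - c * b) by ring.
by rewrite w'E v0E v1E !addr0 mulr0.
Qed.

Definition vproj W x := orth_proj B [set` W] x.

Lemma vprojP W x : vproj W x \in W /\ forall w, w \in W ->
  B (x - vproj W x) w = 0.
Proof.
have [y] := orth_decomp_span (vbasis W) x.
rewrite (span_basis (vbasisP W)) => yW xyW.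
have -> // : vproj W x = y.
apply: orth_proj_eq => // u v /= uW vW; exact: memvB.
Qed.

Lemma vproj_mem W x : vproj W x \in W. Proof. by have [] := vprojP W x. Qed.

Lemma vproj_orth W x w : w \in W -> B (x - vproj W x) w = 0.
Proof. by have [_] := vprojP W x; exact. Qed.

Lemma vproj_eq W x y : y \in W -> (forall w, w \in W -> B (x - y) w = 0) ->
  vproj W x = y.
Proof. by move=> yW xy; apply: orth_proj_eq => // u v /= uW vW; exact: memvB.
  Qed.

Lemma vproj_id W x : x \in W -> vproj W x = x.
Proof. by move=> xW; apply: vproj_eq => // w _; rewrite subrr form0l. Qed.

Lemma form_vproj W x w : w \in W -> B (vproj W x) w = B x w.
Proof. by move=> /(vproj_orth x); rewrite formBl; lra. Qed.

Lemma vproj_linear W k x y : vproj W (k *: x + y) = k *: vproj W x + vproj W y.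
Proof.
apply: vproj_eq => [|w wW]; first by rewrite memvD ?memvZ ?vproj_mem.
by rewrite formBl !formDl !formZl !form_vproj// subrr.
Qed.

Lemma vproj0 W : vproj W 0 = 0. Proof. by rewrite vproj_id ?mem0v. Qed.

Lemma vproj_sub U W x : (U <= W)%VS -> vproj U (vproj W x) = vproj U x.
Proof.
move=> /subvP UW; apply: vproj_eq; first exact: vproj_mem.
by move=> w wU; rewrite formBl !form_vproj ?UW// subrr.
Qed.

(** W is its own double orthogonal; membership is thus proved by testing against vectors orthogonal
    to W. *)
Lemma mem_vprojP W x :
  (forall z, (forall w, w \in W -> B z w = 0) -> B x z = 0) -> x \in W.
Proof.
move=> H; suff <- : vproj W x = x by exact: vproj_mem.
apply/esym/eqP; rewrite -subr_eq0; apply/eqP/form_eq0.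
have H1 : B x (x - vproj W x) = 0 by apply: H => w; exact: vproj_orth.
by rewrite formBl H1 formC (vproj_orth _ (vproj_mem _ _)) subrr.
Qed.

Section Components.
Variables (gs : nat -> {vspace g}) (n : nat).
Hypothesis chain : forall i, (i < n)%N -> (gs i <= gs i.+1)%VS.

Lemma chain_le i j : (i <= j <= n)%N -> (gs i <= gs j)%VS.
Proof.
move=> /andP[]; elim: j => [|j IH]; first by rewrite leqn0 => /eqP->.
rewrite leq_eqVlt => /predU1P[->//|ij] jn.
by apply: subv_trans (chain jn); apply: IH => //; exact: ltnW.
Qed.

Lemma gcomp0E x : gcomp B gs 0 x = vproj (gs 0%N) x. Proof. by []. Qed.

(** This replaces the choice in [orth_proj] by an expression from which linearity and compatibility
    with Ad can be read off. *)
Lemma gcompSE i x : (i < n)%N ->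
  gcomp B gs i.+1 x = vproj (gs i.+1) x - vproj (gs i) x.
Proof.
move=> ni; apply: orth_proj_eq => [u v [uU uo] [vU vo]||w [wW wo]].
- by split=> [|y yU]; [exact: memvB|rewrite formBl uo// vo// subrr].
- split=> [|y yU].
    by rewrite memvB ?vproj_mem// (subvP (chain ni))// vproj_mem.
  by rewrite formBl !form_vproj ?subrr// (subvP (chain ni)).
- by rewrite !formBl form_vproj// (formC (vproj (gs i) x)) wo ?vproj_mem//
  subr0 subrr.
Qed.

Lemma gcomp_mem i x : (i <= n)%N -> pspace B gs i (gcomp B gs i x).
Proof.
case: i => [|i] ni; first exact: vproj_mem.
rewrite gcompSE//; split=> [|y yU].
  by rewrite memvB ?vproj_mem// (subvP (chain ni))// vproj_mem.
by rewrite formBl !form_vproj ?subrr// (subvP (chain ni)).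
Qed.

Lemma gcomp_linear i k x y : (i <= n)%N ->
  gcomp B gs i (k *: x + y) = k *: gcomp B gs i x + gcomp B gs i y.
Proof.
case: i => [|i] ni; first by rewrite !gcomp0E vproj_linear.
by rewrite !gcompSE// !vproj_linear scalerBr opprD addrACA.
Qed.

Lemma gcomp_zero i : (i <= n)%N -> gcomp B gs i 0 = 0.
Proof. by move=> ni; have := gcomp_linear (-1) 0 0 ni;
  rewrite scaler0 addr0 scaleN1r addNr. Qed.

Lemma gcompD i x y : (i <= n)%N ->
  gcomp B gs i (x + y) = gcomp B gs i x + gcomp B gs i y.
Proof. by move=> ni; have := gcomp_linear 1 x y ni; rewrite !scale1r. Qed.

Lemma form_gcomp i x w : (i <= n)%N -> pspace B gs i w ->
  B (gcomp B gs i x) w = B x w.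
Proof.
case: i => [|i] ni /= ; first by move=> w0; rewrite gcomp0E form_vproj.
move=> [wU wo]; rewrite gcompSE// formBl form_vproj//.
by rewrite (formC (vproj (gs i) x)) wo ?vproj_mem// subr0.
Qed.

Lemma pspace_orth i j v w : (i < j <= n)%N -> pspace B gs i v ->
  pspace B gs j w ->
  B v w = 0.
Proof.
case: j => // j /andP[ij jn] vi [_ wo]; rewrite formC wo//.
have vU : v \in gs i by case: i {ij} vi => [//|i []].
by rewrite (subvP (chain_le _) _ vU)// -ltnS ij ltnW.
Qed.

Lemma gcomp_pspace i j v : (i <= n)%N -> (j <= n)%N -> pspace B gs i v ->
  gcomp B gs j v = if i == j then v else 0.
Proof.
move=> ni nj vi; have gj := gcomp_mem v nj; have [ij|ij] := eqVneq i j.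
  rewrite -{}ij in gj nj *; apply/esym/eqP; rewrite -subr_eq0;
    apply/eqP/form_eq0.
  by rewrite formBr !formBl (form_gcomp v nj vi) (form_gcomp v nj gj) !subrr.
apply: form_eq0; rewrite form_gcomp//.
by case: ltngtP ij => // ij _; [|rewrite formC]; apply:
  pspace_orth vi gj || apply: pspace_orth gj vi; rewrite ij.
Qed.

Lemma gcomp_uptoE i x : (i <= n)%N -> gcomp_upto B gs i x = vproj (gs i) x.
Proof.
rewrite /gcomp_upto; elim: i => [|i IH] ni.
  by rewrite big_nat1.
by rewrite big_nat_recr//= IH ?(ltnW ni)// gcompSE// addrCA subrr addr0.
Qed.

Lemma gcomp_sum i (J : Type) (r : seq J) (P : pred J) (F : J -> g) :
  (i <= n)%N ->
  gcomp B gs i (\sum_(j <- r | P j) F j) =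
    \sum_(j <- r | P j) gcomp B gs i (F j).
Proof.
by move=> ni; elim/big_rec2: _ => [|j a b _ <-]; rewrite ?gcomp_zero// gcompD.
Qed.

Lemma gcomp_dsum (P : pred nat) (v : nat -> g) i : (1 <= i <= n)%N -> P i ->
  (forall j, P j -> pspace B gs j (v j)) ->
  gcomp B gs i (\sum_(1 <= j < n.+1 | P j) v j) = v i.
Proof.
move=> /andP[i1 ni] Pi vP; rewrite gcomp_sum//.
rewrite big_mkcond (bigD1_seq i) ?iota_uniq ?mem_index_iota ?i1//=.
rewrite Pi (gcomp_pspace ni ni (vP i Pi)) eqxx big1_seq ?addr0// => j.
rewrite mem_index_iota => /andP[ji /andP[j1 jn]]; case: ifPn => // Pj.
by rewrite (gcomp_pspace jn ni (vP j Pj)) (negbTE ji).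
Qed.

Variables (I : pred nat) (s : nat -> R).
Hypothesis subI : forall i, I i -> (1 <= i <= n)%N.
Hypothesis s_gt0 : forall i, I i -> 0 < s i.
Hypothesis s_eq0 : forall i, (1 <= i <= n)%N -> ~~ I i -> s i = 0.

(* The differential of H_sR at [x]. *)
Definition inertia x : g := \sum_(1 <= i < n.+1) s i *: gcomp B gs i x.

Lemma inertia_cond x : inertia x = \sum_(1 <= i < n.+1 | I i) s i *:
  gcomp B gs i x.
Proof.
rewrite /inertia [RHS]big_mkcond; apply: eq_big_nat => i /andP[i1 ni].
by case: ifPn => // Ii; rewrite s_eq0 ?i1// scale0r.
Qed.

Lemma inertia_dspace x : dspace B gs n I (inertia x).
Proof.
exists (fun i => s i *: gcomp B gs i x); split; last exact: inertia_cond.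
move=> i Ii; have /andP[_ ni] := subI Ii; move: (gcomp_mem x ni).
case: i {Ii} ni => [|i] ni /=; first exact: memvZ.
by move=> [xi xo]; split=> [|y yi]; rewrite ?memvZ// formZl xo// mulr0.
Qed.

Lemma gcomp_inertia i x : I i -> gcomp B gs i (inertia x) = s i *:
  gcomp B gs i x.
Proof.
move=> Ii; rewrite inertia_cond.
apply: (gcomp_dsum (v := fun i => s i *: gcomp B gs i x)) => //; first exact:
  subI.
move=> j Ij; have /andP[_ nj] := subI Ij; move: (gcomp_mem x nj).
case: j {Ij} nj => [|j] nj /=; first exact: memvZ.
by move=> [xi xo]; split=> [|y yi]; rewrite ?memvZ// formZl xo// mulr0.
Qed.

(** The weights s_i and 1 / s_i cancel: [inertia x] is the vector of d which represents the covector
    <x, .> for the sub-Riemannian metric. *)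
Lemma sR_metric_inertia x xi : dspace B gs n I xi ->
  sR_metric B gs n I s (inertia x) xi = B x xi.
Proof.
move=> [v [vI ->]]; rewrite form_sumr /sR_metric big_nat_cond [RHS]big_nat_cond.
apply: eq_bigr => i /andP[/andP[i1 ni] Ii].
rewrite gcomp_inertia// gcomp_dsum ?i1// formZl mulrA mulVf ?gt_eqF ?s_gt0//.
by rewrite mul1r form_gcomp//; exact: vI.
Qed.

Lemma sR_metricC xi eta :
  sR_metric B gs n I s xi eta = sR_metric B gs n I s eta xi.
Proof. by apply: eq_bigr => i _; rewrite formC. Qed.

Lemma sR_metric_linear k xi eta zeta :
  sR_metric B gs n I s (k *: xi + eta) zeta =
  k * sR_metric B gs n I s xi zeta + sR_metric B gs n I s eta zeta.
Proof.
rewrite /sR_metric mulr_sumr -big_split/= big_nat_cond [RHS]big_nat_cond.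
apply: eq_bigr => i /andP[/andP[_ ni] _].
by rewrite gcomp_linear// formDl formZl; ring.
Qed.

Lemma sR_metric_ge0 xi : 0 <= sR_metric B gs n I s xi xi.
Proof.
by apply: sumr_ge0 => i /s_gt0/ltW si; rewrite mulr_ge0 ?invr_ge0// form_ge0.
Qed.

(** The form is only semidefinite on g, being blind to the components outside I. For a null [eta]
    the quadratic in k degenerates to an affine function, which is bounded below only if its slope
    vanishes. *)
Lemma sR_metric_CauchySchwarz xi eta :
  sR_metric B gs n I s xi eta ^+ 2 <=
  sR_metric B gs n I s xi xi * sR_metric B gs n I s eta eta.
Proof.
have H k : 0 <= k ^+ 2 * sR_metric B gs n I s eta eta +
    2 * k * sR_metric B gs n I s xi eta + sR_metric B gs n I s xi xi.
  have := sR_metric_ge0 (k *: eta + xi).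
  rewrite sR_metric_linear ![sR_metric _ _ _ _ _ _ (k *: eta + xi)]sR_metricC.
  by rewrite !sR_metric_linear (sR_metricC eta xi); congr (0 <= _); ring.
have [r0|r0] := eqVneq (sR_metric B gs n I s eta eta) 0.
  rewrite r0 mulr0 in H *; suff -> :
    sR_metric B gs n I s xi eta = 0 by rewrite expr0n.
  apply/eqP/negPn/negP => q0; move: H;
    set q := sR_metric _ _ _ _ _ xi eta in q0 *.
  set p := sR_metric _ _ _ _ _ _ _ => /(_ (- (p + 1) / (2 * q))).
  rewrite (_ : _ + _ + _ = -1) ?oppr_ge0 ?ler10//.
  by field.
have := H (- sR_metric B gs n I s xi eta / sR_metric B gs n I s eta eta).
have rgt0 : 0 < sR_metric B gs n I s eta eta by rewrite lt_def r0 sR_metric_ge0.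
set q := sR_metric _ _ _ _ _ xi eta; set p := sR_metric _ _ _ _ _ xi xi.
move: r0 rgt0; set r := sR_metric _ _ _ _ _ eta eta => r0 rgt0.
have -> : (- q / r) ^+ 2 * r + 2 * (- q / r) * q + p =
  (p * r - q ^+ 2) / r by field.
by rewrite pmulr_lge0 ?invr_gt0// subr_ge0.
Qed.

(** Cauchy-Schwarz against the representing vector bounds the supremum by Q, and the unit vector
    along [inertia x] attains it; when Q = 0 it is attained at 0. *)
Lemma sR_hamiltonianE x : sR_hamiltonian B gs n I s x = 2^-1 * B (inertia x) x.
Proof.
rewrite /sR_hamiltonian; congr (_ * _).
set E := [set _ | _ in _]; set Q := B (inertia x) x.
have QE : Q = sR_metric B gs n I s (inertia x) (inertia x).
  by rewrite (sR_metric_inertia _ (inertia_dspace x)) formC.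
have Q0 : 0 <= Q by rewrite QE sR_metric_ge0.
have EQ : E Q.
  pose c := (Num.sqrt Q)^-1.
  have [Qe|Qe] := eqVneq Q 0.
    exists 0; last by rewrite form0r expr0n Qe.
    split; first by exists (fun=> 0); split=> [i /subI/andP[_ ni]|];
      [rewrite -(gcomp_zero ni); exact: gcomp_mem|rewrite big1].
    have -> : sR_metric B gs n I s 0 0 = 0; last exact: ler01.
    rewrite /sR_metric big_nat_cond big1// => i /andP[/andP[_ ni] _].
    by rewrite gcomp_zero// form0l mulr0.
  have sq : Num.sqrt Q ^+ 2 = Q by rewrite sqr_sqrtr.
  have s0 : Num.sqrt Q != 0 by rewrite sqrtr_eq0 -ltNge lt_def Qe.
  exists (c *: inertia x); last first.
    by rewrite formZr formC -/Q exprMn /c exprVn sq; field.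
  split.
    have [v [vI vE]] := inertia_dspace x.
    exists (fun i => c *: v i); split=> [i Ii|]; last by rewrite vE scaler_sumr.
    move: (vI i Ii) => vi; case: i {Ii} vi => [|i] /=; first exact: memvZ.
    by move=> [xi xo]; split=> [|y yi]; rewrite ?memvZ// formZl xo// mulr0.
  have Z k xi eta : sR_metric B gs n I s (k *:
    xi) eta = k * sR_metric B gs n I s xi eta.
    rewrite -[k *: xi]addr0 sR_metric_linear [sR_metric _ _ _ _ _ 0 _](_ :
      _ = 0) ?addr0//.
    rewrite /sR_metric big_nat_cond big1// => i /andP[/andP[_ ni] _].
    by rewrite gcomp_zero// form0l mulr0.
  rewrite Z sR_metricC Z -QE mulrA -expr2 /c exprVn sq mulVf//.
have ubQ : ubound E Q.
  move=> _ [xi [xid m1] <-]; rewrite -sR_metric_inertia//.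
  rewrite (le_trans (sR_metric_CauchySchwarz _ _))// -QE.
  by rewrite -[leRHS]mulr1 ler_wpM2l.
apply/eqP; rewrite eq_le; apply/andP; split.
  by apply: ge_sup => //; exists Q.
by apply: ub_le_sup => //; exists Q.
Qed.

Lemma inertia_linear k x y : inertia (k *: x + y) = k *: inertia x + inertia y.
Proof.
rewrite /inertia scaler_sumr -big_split/=; apply: eq_big_nat => i /andP[_ ni].
by rewrite gcomp_linear// scalerDr !scalerA (mulrC k).
Qed.

Lemma inertia_adj x y : B (inertia x) y = B x (inertia y).
Proof.
rewrite /inertia form_suml form_sumr; apply: eq_big_nat => i /andP[_ ni].
rewrite formZl formZr; congr (_ * _).
by rewrite -(form_gcomp x ni (gcomp_mem y ni)) formC -(form_gcomp y ni
  (gcomp_mem x ni)) formC.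
Qed.

Lemma derive_sR_hamiltonian b x :
  'D_b (sR_hamiltonian B gs n I s) x = B (inertia x) b.
Proof.
have -> : sR_hamiltonian B gs n I s = fun x => 2^-1 * B (inertia x) x.
  by apply/funext => y; exact: sR_hamiltonianE.
suff D : is_derive (0 : R) 1 (fun h : R => 2^-1 * B (inertia (h *:
  b + x)) (h *: b + x))
    (B (inertia x) b).
  have [_ <-] := D; rewrite /derive; set F := (F in lim (F @ _) = _).
  set F' := (F' in _ = lim (F' @ _)); have -> // : F = F'.
  by apply/funext => h; rewrite /F /F' /= addr0 scale0r add0r [h%:A]mulr1.
have dl : is_derive (0 : R) 1 (fun h : R => h *: b + x) b.
  have := is_derive_affine x b 0; congr (is_derive _ _ _ _).
  by apply/funext => h; rewrite addrC.
have di : is_derive (0 : R) 1 (fun h : R => inertia (h *: b + x)) (inertia b).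
  have := is_derive_affine (inertia x) (inertia b) 0; congr (is_derive _ _ _ _).
  by apply/funext => h; rewrite inertia_linear addrC.
have := is_deriveZ 2^-1 (is_derive_form di dl).
rewrite scale0r add0r inertia_adj (formC b) => D.
by apply: (is_derive_eq D); rewrite /GRing.scale/=; lra.
Qed.

(* With V the component of Y orthogonal to W, V' = L V modulo W, hence <V, V>
   is constant. *)
Lemma skew_flow_stable W (L : g -> g) (Y : R -> g) (t : R) :
  {morph L : x y / x + y} -> (forall x, B (L x) x = 0) ->
  (forall x, x \in W -> L x \in W) -> Y 0 \in W ->
  (forall r : R, is_derive r 1 Y (L (Y r))) -> Y t \in W.
Proof.
move=> LD Lskew LW Y0 dY.
pose PL : {linear g -> g} :=
  HB.pack (vproj W) (GRing.isLinear.Build R g g *:%R (vproj W) (vproj_linear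
    W)).
pose V r : g := Y r - vproj W (Y r).
have dV (r : R) : is_derive r 1 V (L (Y r) - vproj W (L (Y r))).
  exact: is_deriveB (dY r) (is_derive_linear PL (dY r)).
have Vo r w : w \in W -> B (V r) w = 0 by exact: vproj_orth.
have dN (r : R) : is_derive r 1 (fun r => B (V r) (V r)) 0.
  have := is_derive_form (dV r) (dV r); congr (is_derive _ _ _ _).
  rewrite [B (V r) (_ - _)]formC -mulr2n formBl [B (vproj _ _) _]formC.
  rewrite Vo ?vproj_mem// subr0.
  have YE : Y r = V r + vproj W (Y r) by rewrite subrK.
  rewrite [in L (Y r)]YE LD formDl Lskew add0r formC Vo ?mul0rn//.
  exact/LW/vproj_mem.
have E := @is_derive0_cst R setT _ _ (fun r _ => dN r) 0 t Logic.I Logic.I.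
have : V t = 0 by apply: form_eq0; rewrite -E// /V (vproj_id Y0) subrr form0l.
by move=> /eqP; rewrite subr_eq0 => /eqP ->; exact: vproj_mem.
Qed.

(** * Geodesics *)

Section Geodesics.
Variable G : lieGroupType R d.
Hypothesis invB : Ad_invariant G B.

Lemma form_lie_bracket x y z :
  B (lie_bracket G x y) z = - B y (lie_bracket G x z).
Proof.
have V := vel_ray G x.
have D := is_derive_form (vel_Ad y V) (vel_Ad z V).
have D0 : is_derive (0 : R) 1
    (fun r => B (lie_Ad (pa1 G (r *: x)) y) (lie_Ad (pa1 G (r *: x)) z)) 0.
  rewrite (_ : (fun r => _) = cst (B y z)); first exact: is_derive_cst.
  by apply/funext => r; rewrite invB.
have := is_derive_unique D D0.
by rewrite scale0r pa1_0 !lie_Ad1 => /eqP; rewrite addr_eq0 => /eqP.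
Qed.

Lemma form_lie_Ad (a : G) x y : B (lie_Ad a x) y = B x (lie_Ad (a^-1)%g y).
Proof. by rewrite -[RHS](invB a) lie_AdVK. Qed.

(** Ad_a is an isometry; as its inverse preserves W, Ad_a preserves the orthogonal of W as well. *)
Lemma vproj_lie_Ad W (a : G) x :
  (forall y, y \in W -> lie_Ad a y \in W) ->
  (forall y, y \in W -> lie_Ad (a^-1)%g y \in W) ->
  vproj W (lie_Ad a x) = lie_Ad a (vproj W x).
Proof.
move=> aW a'W; apply: vproj_eq => [|w wW]; first by rewrite aW// vproj_mem.
by rewrite -lie_AdB form_lie_Ad vproj_orth// a'W.
Qed.

(** The bracket is the derivative of Ad_(p r) y along a curve [p] in [A]. This path stays in W, so
    its pairing with a vector orthogonal to W has zero derivative. *)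
Lemma lie_subgroup_bracket (A : set G) W x y : lie_subgroup A W ->
  x \in W -> y \in W -> lie_bracket G x y \in W.
Proof.
move=> subA xW yW; have [p Ap vp] := lie_subgroup_curve subA xW.
apply: mem_vprojP => z zW; rewrite formC.
have zo (w : g) : w \in W -> B w z = 0 by move=> wW; rewrite formC zW.
have dz : is_derive (0 : R) 1 (fun=> z) 0 by exact: is_derive_cst.
have D := is_derive_form (vel_Ad y vp) dz.
rewrite /= form0r addr0 in D; rewrite formC.
apply: is_derive_unique D _.
rewrite (_ : (fun r => _) = cst 0); first exact: is_derive_cst.
by apply/funext => r; rewrite zo// (lie_subgroup_Ad subA (Ap r)).
Qed.

Lemma form_lie_bracket0 x y : B (lie_bracket G x y) y = 0.
Proof.
have := form_lie_bracket x y y; have := formC y (lie_bracket G x y).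
by move: (B y _) (B _ y) => p q -> /eqP;
  rewrite -addr_eq0 -mulr2n mulrn_eq0 => /eqP.
Qed.

(** Nothing here places [c] in [A]. The path Ad_(c r) y solves Y' = [x, Y], where ad_x is skew and
    preserves W, so [skew_flow_stable] applies. *)
Lemma one_parameter_stable (A : set G) W x y (c : R -> G) (t : R) :
  lie_subgroup A W -> one_parameter_subgroup x c ->
  x \in W -> y \in W -> lie_Ad (c t) y \in W.
Proof.
move=> subA cx xW yW.
apply: (@skew_flow_stable W (lie_bracket G x) (fun r => lie_Ad (c r) y)).
- exact: lie_bracketDr.
- exact: form_lie_bracket0.
- by move=> z; exact: lie_subgroup_bracket subA xW.
- by rewrite (one_parameter0 cx) lie_Ad1.
move=> r; have V0 : vel c x by apply/velP; split; [exact: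
  one_parameter0 cx|exact: cx.2].
apply/is_derive_addP; have := vel_Ad (lie_Ad (c r) y) V0;
  congr (is_derive _ _ _ _).
by apply/funext => h; rewrite -lie_AdM -(one_parameterD cx).
Qed.

Lemma lie_Ad0r (a : G) : lie_Ad a 0 = 0.
Proof. by have := lie_AdZ a 0 0; rewrite !scale0r. Qed.

Lemma summation_by_parts (r : nat -> R) (p : nat -> g) (k : nat) : p 0%N = 0 ->
  \sum_(1 <= i < k.+1) r i *: (p i - p i.-1) =
  r k *: p k + \sum_(1 <= i < k) (r i - r i.+1) *: p i.
Proof.
move=> p0; elim: k => [|k IH]; first by rewrite !big_geq// p0 scaler0 addr0.
rewrite big_nat_recr//= IH.
case: k {IH} => [|k]; first by rewrite !big_geq// p0 scaler0 !add0r subr0 addr0.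
rewrite [in RHS]big_nat_recr//= scalerBr scalerBl.
by move: (\sum_(_ <= _ < _) _) => S; rowring.
Qed.

Hypothesis compactG : compact [set: G].
Variable Gs : nat -> set G.
Hypothesis subGs : forall i, (i <= n)%N -> lie_subgroup (Gs i) (gs i).
Hypothesis chainGs : forall i, (i < n)%N -> Gs i `<=` Gs i.+1.
Hypothesis topgs : gs n = fullv.
Hypothesis n_gt0 : (0 < n)%N.

Lemma chain_subset i j : (i <= j <= n)%N -> Gs i `<=` Gs j.
Proof.
move=> /andP[]; elim: j => [|j IH]; first by rewrite leqn0 => /eqP-> _.
rewrite leq_eqVlt => /predU1P[-> _|ij jn]; first exact: subset_refl.
by apply: subset_trans (chainGs jn); apply: IH => //; exact: ltnW.
Qed.

Lemma vproj_Ad0 (k : G) i x : Gs 0%N k -> (i <= n)%N ->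
  vproj (gs i) (lie_Ad k x) = lie_Ad k (vproj (gs i) x).
Proof.
move=> Kk ni; have Ki : Gs i k by apply: (chain_subset (i := 0%N)) Kk;
  rewrite ni.
have KiV := lie_subgroupV (subGs ni) Ki.
apply: vproj_lie_Ad => y yi; first exact: (lie_subgroup_Ad (subGs ni) Ki yi).
exact: (lie_subgroup_Ad (subGs ni) KiV yi).
Qed.

Lemma inertia_Ad0 (k : G) x : Gs 0%N k ->
  inertia (lie_Ad k x) = lie_Ad k (inertia x).
Proof.
move=> Kk; rewrite /inertia.
have -> : lie_Ad k (\sum_(1 <= i < n.+1) s i *: gcomp B gs i x) =
    \sum_(1 <= i < n.+1) lie_Ad k (s i *: gcomp B gs i x).
  exact: (linear_sum (lie_Ad k)).
apply: eq_big_nat => -[//|i] /andP[_ ni].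
by rewrite lie_AdZ !gcompSE// lie_AdB !vproj_Ad0// ltnW.
Qed.

(** * The product of exponentials and its momentum *)

Section Flow.
Variable x : g.

(* The convention is s_(n+1) = 0. *)
Definition flow_rate (i : nat) : R := if i == n then s n else s i - s i.+1.

Definition flow_factor (i : nat) (t : R) :
  G := lie_exp G ((t * flow_rate i) *: vproj (gs i) x).

(* The product of the last [j] exponentials of the theorem. *)
Fixpoint flow (j : nat) (t : R) : G :=
  if j is i.+1 then (flow_factor i.+1 t * flow i t)%g else 1%g.

Lemma flow_factor_one_parameter i :
  one_parameter_subgroup (flow_rate i *: vproj (gs i) x) (flow_factor i).
Proof.
have := one_parameter_scale (flow_rate i) (lie_expP compactG (vproj (gs i) x)).
by congr (one_parameter_subgroup _ _); apply/funext => t;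
  rewrite /flow_factor mulrC.
Qed.

Lemma flow_factorV i t : ((flow_factor i t)^-1)%g = flow_factor i (- t).
Proof. by rewrite (one_parameterN (flow_factor_one_parameter i)). Qed.

Lemma flow_factor_fix i t :
  lie_Ad (flow_factor i t) (vproj (gs i) x) = vproj (gs i) x.
Proof. exact: (one_parameter_Ad (lie_expP compactG (vproj (gs i) x)) (t *
  flow_rate i)). Qed.

Lemma flow_factor_stable i j t y : (i <= j <= n)%N -> y \in gs j ->
  lie_Ad (flow_factor i t) y \in gs j.
Proof.
move=> ijn; have jn : (j <= n)%N by case/andP: ijn.
apply: (one_parameter_stable t (subGs jn) (flow_factor_one_parameter i)).
by rewrite memvZ// (subvP (chain_le ijn))// vproj_mem.
Qed.

Lemma flow_stable i j t y : (i <= j <= n)%N -> y \in gs j ->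
  lie_Ad (flow i t) y \in gs j /\ lie_Ad ((flow i t)^-1)%g y \in gs j.
Proof.
elim: i y => [|i IH] y /= ijn yj; first by rewrite invg1 lie_Ad1.
have /IH{}IH : (i <= j <= n)%N by case/andP: ijn => ij ->; rewrite ltnW.
rewrite invgM flow_factorV !lie_AdM; split; last by apply: (IH _ _).2; exact:
  flow_factor_stable.
by apply: flow_factor_stable => //; exact: (IH _ yj).1.
Qed.

(** The product rule conjugates each generator by the factors to its right; its own factor fixes it
    and may be included, which gives a uniform expression in [flow i]. *)
Lemma flow_velocity j t : left_velocity (flow j) t
  (\sum_(1 <= i < j.+1) flow_rate i *:
    lie_Ad ((flow i t)^-1)%g (vproj (gs i) x)).
Proof.
elim: j => [|j IH]; first by rewrite big_geq//; exact: left_velocity_cst.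
have := left_velocity_mul (one_parameter_velocity (flow_factor_one_parameter
  j.+1) t) IH.
congr left_velocity; rewrite [RHS]big_nat_recr//= addrC; congr (_ + _).
by rewrite invgM lie_AdM flow_factorV flow_factor_fix lie_AdZ.
Qed.

(** The outermost factor fixes the projection of [x] to its own subalgebra and can be removed; what
    remains is [flow j], which preserves g_j and so commutes with the projection there. *)
Lemma flow_proj i j t : (i <= j <= n)%N ->
  vproj (gs i) (lie_Ad ((flow j t)^-1)%g (vproj (gs j) x)) =
  lie_Ad ((flow i t)^-1)%g (vproj (gs i) x).
Proof.
elim: j => [|j IH].
  by rewrite leqn0 => /andP[/eqP-> _]; rewrite /= invg1 !lie_Ad1 vproj_sub.
move=> /andP[]; rewrite leq_eqVlt => /predU1P[->|ij] jn.
  apply: vproj_id; have jj : (j.+1 <= j.+1 <= n)%N by rewrite leqnn.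
  exact: (flow_stable t jj (vproj_mem _ _)).2.
have ijn : (i <= j <= n)%N by rewrite -ltnS ij ltnW.
have jjn : (j <= j <= n)%N by rewrite leqnn ltnW.
apply: etrans (IH ijn).
have -> : lie_Ad ((flow j.+1 t)^-1)%g (vproj (gs j.+1) x) =
    lie_Ad ((flow j t)^-1)%g (vproj (gs j.+1) x).
  by rewrite /= invgM lie_AdM flow_factorV flow_factor_fix.
have E : vproj (gs j) (lie_Ad ((flow j t)^-1)%g (vproj (gs j.+1) x)) =
    lie_Ad ((flow j t)^-1)%g (vproj (gs j) x).
  rewrite vproj_lie_Ad ?(vproj_sub _ (chain jn))// => y yj.
    exact: (flow_stable t jjn yj).2.
  by rewrite invgK; exact: (flow_stable t jjn yj).1.
apply: etrans (esym (vproj_sub _ (chain_le ijn))) _.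
by rewrite E.
Qed.

(** Summation by parts, whose boundary term at 0 is the component along k. *)
Lemma inertiaE z : vproj (gs 0%N) z = 0 ->
  inertia z = \sum_(1 <= i < n.+1) flow_rate i *: vproj (gs i) z.
Proof.
move=> z0; pose p i := vproj (gs i) z.
have -> : inertia z = \sum_(1 <= i < n.+1) s i *: (p i - p i.-1).
  by apply: eq_big_nat => -[//|i] /andP[_ ni]; rewrite gcompSE.
rewrite summation_by_parts// big_nat_recr//= /flow_rate eqxx addrC;
  congr (_ + _).
by apply: eq_big_nat => i /andP[_ ni]; rewrite ltn_eqF.
Qed.

Definition momentum t : g := lie_Ad ((flow n t)^-1)%g x.

Hypothesis x0 : vproj (gs 0%N) x = 0.

Lemma vproj_momentum i t : (i <= n)%N ->
  vproj (gs i) (momentum t) = lie_Ad ((flow i t)^-1)%g (vproj (gs i) x).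
Proof.
move=> ni; have nn : (i <= n <= n)%N by rewrite ni leqnn.
rewrite -(flow_proj t nn) [vproj (gs n) x]vproj_id//.
by rewrite topgs memvf.
Qed.

Lemma momentum0 t : vproj (gs 0%N) (momentum t) = 0.
Proof. by rewrite vproj_momentum// x0 lie_Ad0r. Qed.

Lemma flow_inertia t : left_velocity (flow n) t (inertia (momentum t)).
Proof.
have := flow_velocity n t; congr left_velocity.
rewrite inertiaE ?momentum0//; apply: eq_big_nat => i /andP[_ ni].
by rewrite vproj_momentum.
Qed.

Lemma momentum_derive (t : R) :
  is_derive t 1 momentum (- lie_bracket G (inertia (momentum t)) (momentum t)).
Proof.
have V := left_velocity_Ad_cst x (left_velocity_inv (flow_inertia t)).
apply: (is_derive_eq V).
by rewrite lie_Ad_bracket -scaleN1r lie_AdZ scaleN1r lie_AdK lie_bracketNl.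
Qed.

(** The recursion puts higher indices on the left, hence the reversed list; [index_iota 1 n] stops
    at n - 1, the factor of index n being written apart with its rate s_n. *)
Lemma flowE t : flow n t = (lie_exp G ((t * s n) *: x)%R *
  \prod_(i <- rev (index_iota 1 n))
     lie_exp G ((t * (s i - s i.+1)) *: gcomp_upto B gs i x)%R)%g.
Proof.
have H j : (j < n)%N -> flow j t = (\prod_(i <- rev (index_iota 1 j.+1))
     lie_exp G ((t * (s i - s i.+1)) *: gcomp_upto B gs i x)%R)%g.
  elim: j => [|j IH] jn /=; first by rewrite big_nil.
  have -> : index_iota 1 j.+2 = rcons (index_iota 1 j.+1) j.+1.
    rewrite -cats1 /index_iota !subSS !subn0.
    by have := iotaD 1 j 1; rewrite addn1 add1n => ->.
  by rewrite rev_rcons big_cons IH ?(ltnW jn)//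
    /flow_factor /flow_rate ltn_eqF// gcomp_uptoE// ltnW.
rewrite -(prednK n_gt0) /= H ?prednK// /flow_factor /flow_rate eqxx.
by rewrite (vproj_id (_ : x \in gs n)) ?topgs ?memvf.
Qed.

End Flow.

(** * From normal geodesics to products of exponentials and back *)

Lemma translateM (a k : G) : Gs 0%N k ->
  translate (a * k)%g (Gs 0%N) = translate a (Gs 0%N).
Proof.
have KM := lie_subgroupM (subGs (leq0n n));
  have KV := lie_subgroupV (subGs (leq0n n)).
move=> Kk; apply/seteqP; split=> [_ [b Kb <-]|_ [b Kb <-]].
  by exists (k * b)%g; [exact: KM|rewrite mulgA].
by exists (k^-1 * b)%g; [apply: KM => //; exact: KV|rewrite mulgA mulgK].
Qed.

(** Skewness of ad moves the bracket onto [x], so that the coefficients of [b] and [eta]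
    separate. *)
Lemma canonical_symplecticE x xi a eta b :
  canonical_symplectic G B x (xi, a) (eta, b) =
  B xi b - B (a + lie_bracket G xi x) eta.
Proof.
by rewrite /canonical_symplectic /= formDl form_lie_bracket opprD opprK addrA.
Qed.

Lemma flow_geodesic x (J : set R) (gam : R -> set G) : vproj (gs 0%N) x = 0 ->
  (forall t, J t -> gam t = translate (flow x n t) (Gs 0%N)) ->
  normal_geodesic B gs n I s (Gs 0%N) J gam.
Proof.
move=> x0 gamE; exists (flow x n), (momentum x), (fun t =>
  inertia (momentum x t)),
  (fun t => - lie_bracket G (inertia (momentum x t)) (momentum x t)) => t Jt.
split=> [||||eta b _].
- exact: gamE.
- by rewrite gcomp0E momentum0.
- exact: flow_inertia.
- exact: momentum_derive.
- by rewrite canonical_symplecticE addNr form0l subr0 derive_sR_hamiltonian.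
Qed.

(* The Hamilton equations determine the velocity xi only modulo k. *)
Lemma hamilton_equations x xi a :
  (forall eta b, gcomp B gs 0 b = 0 ->
    canonical_symplectic G B x (xi, a) (eta, b) =
     'D_b (sR_hamiltonian B gs n I s) x) ->
  xi - inertia x \in gs 0%N /\ a = - lie_bracket G xi x.
Proof.
move=> H; split.
  apply: mem_vprojP => z z0.
  have z0' : gcomp B gs 0 z = 0.
    by rewrite gcomp0E; apply: vproj_eq => [|w /z0]; rewrite ?mem0v// subr0.
  have := H 0 z z0'; rewrite canonical_symplecticE form0r subr0
    derive_sR_hamiltonian.
  by move=> E; rewrite formBl E subrr.
apply/eqP; rewrite -addr_eq0; apply/eqP/form_ext => eta; rewrite form0l.
have g0 : gcomp B gs 0 0 = 0 by rewrite gcomp0E vproj0.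
have := H eta 0 g0; rewrite canonical_symplecticE derive_sR_hamiltonian !form0r
  sub0r.
by move=> /eqP; rewrite oppr_eq0 => /eqP.
Qed.

(** Conservation of the momentum of the left action of G, by the product rule for Ad_u x. *)
Lemma momentum_map_cst (J : set R) (u : R -> G) (x xi : R -> g) :
  is_interval J ->
  (forall t, J t -> left_velocity u t (xi t)) ->
  (forall t : R, J t -> is_derive t 1 x (- lie_bracket G (xi t) (x t))) ->
  forall r t, J r -> J t -> lie_Ad (u r) (x r) = lie_Ad (u t) (x t).
Proof.
move=> itvJ du dx r t Jr Jt; apply/rowP => i.
apply: (@is_derive0_cst R J (fun r => lie_Ad (u r) (x r) 0 i)) => // r' Jr'.
have /is_derive_mxP/(_ i) := left_velocity_Ad (du r' Jr') (dx r' Jr').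
by rewrite subrr lie_Ad0r mxE.
Qed.

Lemma inertia_bound : exists2 C : R, 0 < C & forall z, `|inertia z| <= C * `|z|.
Proof.
pose L : {linear g -> g} :=
  HB.pack inertia (GRing.isLinear.Build R g g *:%R inertia inertia_linear).
exact: (linear_rV_bound L).
Qed.

(** s Ad - Ad s = s (Ad - 1) - (Ad - 1) s, where Ad - 1 is O(|y|); each of the two terms contributes
    C D. *)
Lemma inertia_commutator : exists C r : R, [/\ 0 <= C, 0 < r &
  forall y z, `|y| <= r ->
  `|inertia (lie_Ad ((pa1 G y)^-1)%g z) - lie_Ad ((pa1 G y)^-1)%g (inertia z)|
    <=
  C * `|y| * `|z|].
Proof.
have [C [r [C0 r0 H]]] := lie_AdV_near G; have [D D0 HD] := inertia_bound.
exists (2 * C * D), r; split => //; first by rewrite !mulr_ge0// ltW.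
move=> y z yr; set a := ((pa1 G y)^-1)%g.
have -> : inertia (lie_Ad a z) - lie_Ad a (inertia z) =
    inertia (lie_Ad a z - z) - (lie_Ad a (inertia z) - inertia z).
  have -> : inertia (lie_Ad a z) = inertia (lie_Ad a z - z) + inertia z.
    by have := inertia_linear 1 (lie_Ad a z - z) z; rewrite !scale1r subrK.
  by rewrite opprB addrA.
have A1 := le_trans (HD _) (ler_wpM2l (ltW D0) (H y z yr)).
have A2 := H y (inertia z) yr.
have A3 : C * `|y| * `|inertia z| <= C * `|y| * (D * `|z|).
  by rewrite ler_wpM2l// mulr_ge0.
rewrite (le_trans (ler_normB _ _))//.
have -> : 2 * C * D * `|y| * `|z| =
  D * (C * `|y| * `|z|) + C * `|y| * (D * `|z|) by ring.
by rewrite lerD// (le_trans A2).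
Qed.

Hypothesis closedK : closed (Gs 0%N).

(** Modulo k the velocity is c times the commutator of [inertia] and Ad_(h^-1); the scalar is 1
    forward in time and -1 for the reversed curve. *)
Lemma stay_in_K (h : R -> G) (eta Z : R -> g) (c M b : R) : Gs 0%N (h 0) ->
  (forall t, 0 <= t <= b -> left_velocity h t (eta t)) ->
  (forall t, 0 <= t <= b -> `|Z t| <= M) ->
  (forall t, 0 <= t <= b -> eta t - c *: (inertia (lie_Ad ((h t)^-1)%g (Z t)) -
     lie_Ad ((h t)^-1)%g (inertia (Z t))) \in gs 0%N) ->
  forall t, 0 <= t <= b -> Gs 0%N (h t).
Proof.
move=> h0 dh ZM etaK t /andP[t0 tb].
have K0 := subGs (leq0n n).
have [C [r [C0 r0 HC]]] := inertia_commutator.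
have M0 : 0 <= M by rewrite (le_trans _ (ZM 0 _))// lexx (le_trans t0).
apply: (@stay_in_subgroup _ _ _ (Gs 0%N) h eta (`|c| * (C * M)) r b) => //;
  last first.
- by rewrite t0.
- move=> t' y k tb' yr Kk hE;
  have [p Kp vp] := lie_subgroup_curve K0 (etaK t' tb').
  exists p; eexists; split; [exact: Kp|exact: vp|].
  rewrite subKr lie_AdZ normrZ -!mulrA ler_wpM2l// lie_AdB.
  (* For h = pa y * k, [inertia] commutes with Ad of k^-1, so applying Ad_k leaves the commutator at
     (pa y)^-1. *)
  rewrite hE invgM !lie_AdM inertia_Ad0 ?lie_AdVK; last exact:
    lie_subgroupV K0 _ Kk.
  rewrite (le_trans (HC _ _ yr))// -mulrA ler_wpM2l// mulrC ler_wpM2r//.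
  exact: ZM.
- by rewrite !mulr_ge0.
- by move=> k k' Kk Kk'; exact: (lie_subgroupM K0).
- exact: subclosed_compact closedK compactG _.
Qed.

Lemma momentum_bounded x (b : R) : vproj (gs 0%N) x = 0 ->
  exists M : R, forall t, - b <= t <= b -> `|momentum x t| <= M.
Proof.
move=> x0; have [b0|b0] := leP (- b) b; last first.
  by exists 0 => t /andP[bt tb]; have := le_trans bt tb; rewrite leNgt b0.
have [|c _ Hc] := @EVT_max R (fun t => `|momentum x t|) _ _ b0.
  apply: continuous_subspaceT => t; apply: cvg_norm.
  apply: differentiable_continuous; apply/derivable1_diffP.
  by have [] := momentum_derive x0 t.
by exists `|momentum x c| => t tb; apply: Hc; rewrite in_itv.
Qed.

Lemma flow0 x j : flow x j 0 = 1%g.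
Proof.
elim: j => [//|j IH] /=; rewrite IH mulg1.
exact: one_parameter0 (flow_factor_one_parameter x j.+1).
Qed.

Lemma geodesic_flow (J : set R) (gam : R -> set G) : is_interval J -> J 0 ->
  normal_geodesic B gs n I s (Gs 0%N) J gam -> gam 0 = Gs 0%N ->
  exists2 X, vproj (gs 0%N) X = 0 &
    forall t, J t -> gam t = translate (flow X n t) (Gs 0%N).
Proof.
move=> itvJ J0 [u [x [xi [a H]]]] gam0.
have K0 := subGs (leq0n n).
(* The lift starts somewhere in K, not necessarily at 1. *)
have Ku0 : Gs 0%N (u 0).
  have [uK _ _ _ _] := H 0 J0; rewrite -gam0 uK.
  by exists 1%g; [exact: lie_subgroup1 K0|rewrite mulg1].
pose X := lie_Ad (u 0) (x 0).
have du t : J t -> left_velocity u t (xi t) by move=> /H[].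
have ham t : J t -> xi t - inertia (x t) \in gs 0%N /\ a t =
  - lie_bracket G (xi t) (x t).
  by move=> /H[_ _ _ _]; exact: hamilton_equations.
have dx (t : R) : J t -> is_derive t 1 x (- lie_bracket G (xi t) (x t)).
  by move=> Jt; have [_ <-] := ham t Jt; have [] := H t Jt.
have XE t : J t -> lie_Ad (u t) (x t) = X.
  by move=> Jt; exact: momentum_map_cst itvJ du dx _ _ Jt J0.
(* As u(0) lies in K, its Ad commutes with the projection to k. *)
have X0 : vproj (gs 0%N) X = 0.
  have [_ x0 _ _ _] := H 0 J0; rewrite /X vproj_Ad0//.
  by rewrite -gcomp0E x0 lie_Ad0r.
exists X => // t Jt; have [-> _ _ _ _] := H t Jt.
pose h t := ((flow X n t)^-1 * u t)%g.
suff Kh : Gs 0%N (h t) by rewrite -(translateM (flow X n t) Kh) /h mulVKg.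
have hV r : ((h r)^-1 = (u r)^-1 * flow X n r)%g by rewrite /h invgM invgK.
have dh r : J r -> left_velocity h r
    (xi r - lie_Ad ((h r)^-1)%g (inertia (momentum X r))).
  move=> Jr; have := left_velocity_mul (left_velocity_inv (flow_inertia X0 r))
    (du r Jr).
  by congr left_velocity; rewrite addrC hV -scaleN1r lie_AdZ scaleN1r -lie_AdM.
have hx r : J r -> lie_Ad ((h r)^-1)%g (momentum X r) = x r.
  by move=> Jr; rewrite hV lie_AdM /momentum lie_AdVK -(XE r Jr) lie_AdK.
have h0 : Gs 0%N (h 0) by rewrite /h flow0 invg1 mul1g.
have hK r : J r -> xi r - lie_Ad ((h r)^-1)%g (inertia (momentum X r)) -
    (inertia (lie_Ad ((h r)^-1)%g (momentum X r)) -
     lie_Ad ((h r)^-1)%g (inertia (momentum X r))) \in gs 0%N.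
  by move=> Jr; rewrite hx// opprB addrA subrK; case: (ham r Jr).
have [M HM] := momentum_bounded `|t| X0.
have [t0|t0] := leP 0 t.
  have inJ r : 0 <= r <= t -> J r by exact: itvJ.
  apply: (@stay_in_K h _ (momentum X) 1 M t h0 (fun r rt => dh r (inJ r rt))).
  - by move=> r /andP[r0 rt]; apply: HM;
    rewrite ger0_norm// rt andbT (le_trans _ r0)// oppr_le0.
  - by move=> r rt; rewrite scale1r; exact/hK/inJ.
  - by rewrite t0 lexx.
(* Negative times: the reversed curve r |-> h(- r) is followed on [0, - t], and its velocity changes
   sign. *)
have inJ r : 0 <= r <= - t -> J (- r).
  by move=> /andP[r0 rt]; apply: (itvJ t 0) => //; rewrite lerNr rt oppr_le0.
have := @stay_in_K (fun r => h (- r)) _ (fun r =>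
  momentum X (- r)) (- 1) M (- t) _
  (fun r rt => left_velocity_opp (dh _ (inJ r rt))).
rewrite oppr0 => /(_ h0) Hs; rewrite -[t]opprK; apply: Hs.
- move=> r /andP[r0 rt]; apply: HM; rewrite ltr0_norm// opprK lerNr rt/=.
  by move: r0 t0; lra.
- by move=> r rt; rewrite scaleN1r -opprD memvN; exact/hK/inJ.
- by rewrite lexx oppr_ge0 ltW.
Qed.

End Geodesics.
End Components.
End ScalarProduct.

Theorem theorem3 (R : realType) (d : nat) (G : lieGroupType R d)
  (compactG : compact [set: G]) (connectedG : connected [set: G])
  (B : 'rV[R]_d -> 'rV[R]_d -> R)
  (scalarB : scalar_product B) (invB : Ad_invariant G B)
  (n : nat) (Gs : nat -> set G) (gs : nat -> {vspace 'rV[R]_d})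
  (subGs : forall i, (i <= n)%N -> lie_subgroup (Gs i) (gs i))
  (chainGs : forall i, (i < n)%N -> Gs i `<=` Gs i.+1)
  (topGs : Gs n = [set: G])
  (closedK : closed (Gs 0%N))
  (chaings : forall i, (i < n)%N ->
     (gs i <= gs i.+1)%VS /\ gs i <> gs i.+1)
  (topgs : gs n = fullv)
  (I : pred nat) (subI : forall i, I i -> (1 <= i <= n)%N)
  (properI : exists i, (1 <= i <= n)%N /\ ~~ I i)
  (genD : generates G (dspace B gs n I))
  (s : nat -> R) (s_gt0 : forall i, I i -> 0 < s i)
  (s_eq0 : forall i, (1 <= i <= n)%N -> ~~ I i -> s i = 0)
  (J : set R) (openJ : open J) (itvJ : is_interval J) (J0 : J 0)
  (gam : R -> set G) :
  (normal_geodesic B gs n I s (Gs 0%N) J gam /\ gam 0 = Gs 0%N) <->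
  (exists xbar : 'rV[R]_d, gcomp B gs 0 xbar = 0 /\
     forall t : R, J t ->
       gam t = translate (lie_exp G ((t * s n) *: xbar)%R *
         \prod_(i <- rev (index_iota 1 n))
            lie_exp G ((t * (s i - s i.+1)) *: gcomp_upto B gs i xbar)%R)%g
         (Gs 0%N)).
Proof.
have chain i : (i < n)%N -> (gs i <= gs i.+1)%VS by move=> /chaings[].
(* The index missing from I forces n > 0, so that a topmost factor exists. *)
have n_gt0 : (0 < n)%N.
  by have [i [/andP[i1 ni] _]] := properI; exact: leq_trans i1 ni.
have flowE' x t := flowE scalarB chain s G topgs n_gt0 x t.
split=> [[geo gam0]|[x [x0 gamE]]].
  have [x x0 gamE] := geodesic_flow scalarB chain subI s_gt0 s_eq0 invB compactG
    subGs chainGs topgs n_gt0 closedK itvJ J0 geo gam0.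
  by exists x; split=> // t /gamE ->; rewrite flowE'.
have gamE' t : J t -> gam t = translate (flow B gs n s G x n t) (Gs 0%N).
  by move=> /gamE ->; rewrite flowE'.
split.
  exact: (flow_geodesic scalarB chain subI s_gt0 s_eq0 invB compactG subGs topgs
    n_gt0 x0 gamE').
(* At t = 0 every exponential is 1 and the coset is K itself. *)
rewrite gamE'// flow0//.
apply/seteqP; split=> [_ [k Kk <-]|k Kk]; first by rewrite mul1g.
by exists k => //; rewrite mul1g.
Qed.
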